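(* Let $1<p\le2$, let $\Omega\subset\mathbb{R}^n$ be open, bounded and connected with $C^2$ boundary, and let $f\in C(\overline\Omega)\cap W^{1,\infty}(\Omega)$ satisfy $f\ge0$, $f=0$ on $\partial\Omega$, and be uniformly semiconcave in $\overline\Omega$ with semiconcavity constant $c$. Let $\tilde f:\mathbb{R}^n\to\mathbb{R}$ be the extension of $f$ by $\tilde f(x)=0$ for $x\notin\Omega$. Let $u\in C(\overline\Omega)$ be the unique solution of $(\mathrm{PDE}_0)$. (i) If $\tilde f$ is uniformly semiconcave in $\mathbb{R}^n$, then $u$ is uniformly semiconcave in $\overline\Omega$. (ii) In general, $u$ is locally semiconcave. More specifically, there exists a constant $C>0$ independent of $x\in\Omega$ such that for every $x\in\Omega$ there is a constant $M_x>0$, depending on $x$, such that for all $h\in\mathbb{R}^n$ with $|h|\le M_x$ one has $x\pm h\in\Omega$ and $$u(x+h)-2u(x)+u(x-h)\le\frac{C}{d(x)}|h|^2.$$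
   Context: $(\mathrm{PDE}_0)$: $u\in C(\overline\Omega)$ is a viscosity subsolution of $u+|Du|^p-f\le0$ in $\Omega$ and a viscosity supersolution of $u+|Du|^p-f\ge0$ on $\overline\Omega$. The latter means: whenever $\varphi\in C^1(\overline\Omega)$ and $u-\varphi$ attains its minimum over $\overline\Omega$ at a point $x_0\in\overline\Omega$ (possibly on $\partial\Omega$), then $u(x_0)+|D\varphi(x_0)|^p-f(x_0)\ge0$. This problem has a unique solution in $C(\overline\Omega)$. Semiconcavity: a function $g$ is uniformly semiconcave (with linear modulus) in a set $K$ ($K=\overline\Omega$ or $K=\mathbb{R}^n$) with semiconcavity constant $c>0$ if $g(x+h)-2g(x)+g(x-h)\le c|h|^2$ for all $x,h\in\mathbb{R}^n$ such that $x+h,x,x-h\in K$. Function $d$: for small $\delta>0$ let $\Omega_\delta=\{x\in\Omega:\mathrm{dist}(x,\partial\Omega)>\delta\}$ and $\Omega^\delta=\{x\in\mathbb{R}^n:\mathrm{dist}(x,\overline\Omega)<\delta\}$. Let $\rho$ be the signed distance to $\partial\Omega$: $\rho(x)=\mathrm{dist}(x,\partial\Omega)$ for $x\in\overline\Omega$ and $\rho(x)=-\mathrm{dist}(x,\partial\Omega)$ for $x\notin\overline\Omega$. Let $\delta_0=\frac12\sup\{\delta>0:\rho\text{ is }C^2\text{ in }\Omega^\delta\setminus\overline{\Omega}_\delta\}$. Then $d\in C^2(\mathbb{R}^n)$ is a fixed function with $d=\rho$ on $\Omega^{\delta_0}\setminus\Omega_{\delta_0}$, $d>0$ in $\Omega$,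 and $d\le0$ outside $\Omega$. *)

(* Defs.v *)
From HB Require Import structures.
From mathcomp Require Import all_boot all_order all_algebra.
From mathcomp Require Import all_classical all_reals all_analysis.
Set Implicit Arguments.
Unset Strict Implicit.
Unset Printing Implicit Defensive.
Import Order.TTheory GRing.Theory Num.Theory.
Import numFieldNormedType.Exports.
Local Open Scope classical_set_scope.
Local Open Scope ring_scope.

(* The topology of 'rV[R]_n (generated by the sup norm) is the Euclidean one,
   but `|x| is not the Euclidean norm, which is written [enorm] here. *)
Definition enorm (R : realType) (n : nat) (x : 'rV[R]_n) : R :=
  Num.sqrt (\sum_(i < n) x ord0 i ^+ 2).

Definition eucl_dist (R : realType) (n : nat) (x : 'rV[R]_n) (A : set 'rV[R]_n) : R :=
  inf [set enorm (x - y) | y in A].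

Definition boundary (R : realType) (n : nat) (A : set 'rV[R]_n) : set 'rV[R]_n :=
  closure A `\` interior A.

Definition pderiv (R : realType) (n : nat) (i : 'I_n) (f : 'rV[R]_n -> R)
  : 'rV[R]_n -> R := 'D_(delta_mx ord0 i) f.

Definition gradient (R : realType) (n : nat) (f : 'rV[R]_n -> R)
  (x : 'rV[R]_n) : 'rV[R]_n := \row_i pderiv i f x.

(* Functions are total; [Ck k A f] is meant for open [A] and only depends on the
   values of [f] on [A] in that case. *)
Fixpoint Ck (R : realType) (n k : nat) (A : set 'rV[R]_n) (f : 'rV[R]_n -> R)
  : Prop :=
  (forall x, A x -> {for x, continuous f}) /\
  if k is k'.+1 then
    forall i : 'I_n,
      (forall x, A x -> derivable f x (delta_mx ord0 i)) /\
      Ck k' A (pderiv i f)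
  else True.

(* C^1 up to the boundary: [G] is the continuous extension to the closure of
   the gradient, and gives the meaning of the gradient on the boundary. *)
Definition C1_closure (R : realType) (n : nat) (A : set 'rV[R]_n)
  (phi : 'rV[R]_n -> R) (G : 'rV[R]_n -> 'rV[R]_n) : Prop :=
  [/\ {within closure A, continuous phi},
      Ck 1 A phi,
      {within closure A, continuous G}
    & forall x, A x -> G x = gradient phi x].

(* Near every boundary point and after an orthogonal change of coordinates [Q],
   [A] is the strict epigraph of a C^2 function of the first n coordinates. *)
Definition C2_boundary (R : realType) (n : nat) (A : set 'rV[R]_n.+1) : Prop :=
  forall x0, boundary A x0 ->
    exists (r : R) (Q : 'M[R]_n.+1) (gam : 'rV[R]_n -> R),
      [/\ 0 < r, Q *m Q^T = 1%:M, Ck 2 [set: 'rV[R]_n] gam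
        & forall x, enorm (x - x0) < r ->
            (A x <-> gam (col' ord_max (x *m Q)) < (x *m Q) ord0 ord_max)].

(* The n-fold product of a sigma-finite measure, on the product sigma-algebra
   of n.-tuple T: nu^(n+1) is the image of nu \x nu^n by cons. *)
Section power_measure.
Local Open Scope ereal_scope.
Context d (T : measurableType d) (R : realType).
Variable nu : {sigma_finite_measure set T -> \bar R}.

Definition tuple_cons n (x : T * n.-tuple T) : n.+1.-tuple T :=
  [tuple of x.1 :: x.2].

Lemma measurable_tuple_cons n : measurable_fun setT (@tuple_cons n).
Proof. exact: measurable_cons. Qed.

Section step.
Variables (n : nat) (mu : {sigma_finite_measure set (n.-tuple T) -> \bar R}).

Definition cons_measure : set (n.+1.-tuple T) -> \bar R :=
  pushforward (nu \x mu) (@tuple_cons n).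

Let cons_measureM : {measure set (n.+1.-tuple T) -> \bar R} :=
  measure_function_pushforward__canonical__measure_function_Measure
    (nu \x mu) (@measurable_tuple_cons n).

HB.instance Definition _ := isMeasure.Build _ _ _ cons_measure
  (measure0 cons_measureM) (measure_ge0 cons_measureM)
  (@measure_semi_sigma_additive _ _ _ cons_measureM).

Let cons_measure_sigma_finite : sigma_finite setT cons_measure.
Proof.
have /sigma_finiteP[F [TF ndF Foo]] := sigma_finiteT nu.
have /sigma_finiteP[G [TG ndG Goo]] := sigma_finiteT mu.
pose uncons (t : n.+1.-tuple T) : T * n.-tuple T :=
  (thead t, [tuple of behead t]).
have unconsK : cancel (@tuple_cons n) uncons.
  by move=> [x t]; congr pair; apply: val_inj.
have muncons : measurable_fun setT uncons.
  by apply: measurable_fun_pair; [exact: measurable_tnth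
    | exact: measurable_behead].
exists (fun k => uncons @^-1` (F k `*` G k)).
  rewrite -preimage_bigcup; apply/esym; rewrite -subTset => t _ /=.
  have [k _ Fk] : (\bigcup_i F i) (uncons t).1 by rewrite -TF.
  have [l _ Gl] : (\bigcup_i G i) (uncons t).2 by rewrite -TG.
  exists (maxn k l) => //; split.
    by move: Fk; exact/subsetPset/ndF/leq_maxl.
  by move: Gl; exact/subsetPset/ndG/leq_maxr.
move=> k; have [mF Fk] := Foo k; have [mG Gk] := Goo k; split.
  by rewrite -[X in measurable X]setTI; apply: muncons => //; exact: measurableX.
rewrite /cons_measure /pushforward -comp_preimage.
rewrite (_ : uncons \o _ = id); last by apply/funext => x; exact: unconsK.
by rewrite preimage_id product_measure1E// lte_mul_pinfty// ge0_fin_numE.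
Qed.

HB.instance Definition _ := Measure_isSigmaFinite.Build _ _ _ cons_measure
  cons_measure_sigma_finite.

End step.

Fixpoint power_measure (n : nat)
    : {sigma_finite_measure set (n.-tuple T) -> \bar R} :=
  if n is n'.+1 then cons_measure (power_measure n')
  else \d_([tuple] : 0.-tuple T).

End power_measure.

Definition lebesgue_tuple (R : realType) (n : nat)
    : {sigma_finite_measure set (n.-tuple (measurableTypeR R)) -> \bar R} :=
  power_measure (@lebesgue_measure R) n.

Definition row_of_tuple (R : realType) (n : nat) (t : n.-tuple R) : 'rV[R]_n :=
  \row_i tnth t i.

(* Classes of L^infty are represented by Borel functions. *)
Definition Linfty (R : realType) (n : nat) (A : set 'rV[R]_n)
  (g : 'rV[R]_n -> R) : Prop :=
  measurable_fun (row_of_tuple (n := n) @^-1` A : set (n.-tuple (measurableTypeR R)))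
    (g \o row_of_tuple (n := n)) /\
  exists M : R, {ae lebesgue_tuple R n, forall t,
    A (row_of_tuple t) -> `|g (row_of_tuple t)| <= M}.

Definition test_function (R : realType) (n : nat) (A : set 'rV[R]_n)
  (phi : 'rV[R]_n -> R) : Prop :=
  (forall k, Ck k [set: 'rV[R]_n] phi) /\
  exists K : set 'rV[R]_n,
    [/\ compact K, K `<=` A & forall x, ~ K x -> phi x = 0].

Definition weak_pderiv (R : realType) (n : nat) (A : set 'rV[R]_n) (i : 'I_n)
  (f g : 'rV[R]_n -> R) : Prop :=
  forall phi, test_function A phi ->
    (\int[lebesgue_tuple R n]_(t in row_of_tuple (n := n) @^-1` A)
       (f (row_of_tuple t) * pderiv i phi (row_of_tuple t))%:E =
     - \int[lebesgue_tuple R n]_(t in row_of_tuple (n := n) @^-1` A)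
         (g (row_of_tuple t) * phi (row_of_tuple t))%:E)%E.

Definition W1infty (R : realType) (n : nat) (A : set 'rV[R]_n)
  (f : 'rV[R]_n -> R) : Prop :=
  Linfty A f /\
  forall i : 'I_n, exists g, Linfty A g /\ weak_pderiv A i f g.

Definition semiconcave_with (R : realType) (n : nat) (K : set 'rV[R]_n) (c : R)
  (g : 'rV[R]_n -> R) : Prop :=
  0 < c /\
  forall x h, K (x + h) -> K x -> K (x - h) ->
    g (x + h) - 2 * g x + g (x - h) <= c * enorm h ^+ 2.

Definition uniformly_semiconcave (R : realType) (n : nat) (K : set 'rV[R]_n)
  (g : 'rV[R]_n -> R) : Prop :=
  exists c, semiconcave_with K c g.

Definition locally_semiconcave (R : realType) (n : nat) (A : set 'rV[R]_n)
  (g : 'rV[R]_n -> R) : Prop :=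
  forall K, compact K -> K `<=` A -> uniformly_semiconcave K g.

Definition zero_extension (R : realType) (n : nat) (A : set 'rV[R]_n)
  (f : 'rV[R]_n -> R) (x : 'rV[R]_n) : R :=
  if x \in A then f x else 0.

Definition viscosity_subsolution (R : realType) (n : nat) (p : R)
  (Omega : set 'rV[R]_n) (f u : 'rV[R]_n -> R) : Prop :=
  forall phi x0, Ck 1 Omega phi -> Omega x0 ->
    (\forall y \near x0, u y - phi y <= u x0 - phi x0) ->
    u x0 + enorm (gradient phi x0) `^ p - f x0 <= 0.

Definition viscosity_supersolution_closure (R : realType) (n : nat) (p : R)
  (Omega : set 'rV[R]_n) (f u : 'rV[R]_n -> R) : Prop :=
  forall phi G x0, C1_closure Omega phi G -> closure Omega x0 ->
    (forall y, closure Omega y -> u x0 - phi x0 <= u y - phi y) ->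
    0 <= u x0 + enorm (G x0) `^ p - f x0.

Definition PDE0 (R : realType) (n : nat) (p : R) (Omega : set 'rV[R]_n)
  (f u : 'rV[R]_n -> R) : Prop :=
  [/\ {within closure Omega, continuous u},
      viscosity_subsolution p Omega f u
    & viscosity_supersolution_closure p Omega f u].

Definition inner_set (R : realType) (n : nat) (Omega : set 'rV[R]_n) (delta : R)
  : set 'rV[R]_n := [set x | Omega x /\ delta < eucl_dist x (boundary Omega)].

Definition outer_set (R : realType) (n : nat) (Omega : set 'rV[R]_n) (delta : R)
  : set 'rV[R]_n := [set x | eucl_dist x (closure Omega) < delta].

Definition signed_dist (R : realType) (n : nat) (Omega : set 'rV[R]_n)
  (x : 'rV[R]_n) : R :=
  if x \in closure Omega then eucl_dist x (boundary Omega)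
  else - eucl_dist x (boundary Omega).

Definition delta0 (R : realType) (n : nat) (Omega : set 'rV[R]_n) : R :=
  sup [set delta : R | 0 < delta /\
    Ck 2 (outer_set Omega delta `\` closure (inner_set Omega delta))
      (signed_dist Omega)] / 2.

Definition is_distance_extension (R : realType) (n : nat)
  (Omega : set 'rV[R]_n) (d : 'rV[R]_n -> R) : Prop :=
  [/\ Ck 2 [set: 'rV[R]_n] d,
      forall x, (outer_set Omega (delta0 Omega) `\`
                 inner_set Omega (delta0 Omega)) x -> d x = signed_dist Omega x,
      forall x, Omega x -> 0 < d x
    & forall x, ~ Omega x -> d x <= 0].

(* Main.v *)
Require Import Defs.
From mathcomp Require Import all_boot all_order all_algebra.
From mathcomp Require Import all_classical all_reals all_analysis.
From mathcomp Require Import ring lra.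
Set Implicit Arguments.
Unset Strict Implicit.
Unset Printing Implicit Defensive.
Import Order.TTheory GRing.Theory Num.Theory.
Import numFieldNormedType.Exports.
Local Open Scope classical_set_scope.
Local Open Scope ring_scope.

(** Let [U] and [F] be the extensions of [u] and [f] by zero. A constant tested
at a minimum of [u] gives [0 <= u], and paraboloids touch [u] from above on a
dense set of points of [Omega], which gives [u <= f]. Hence [u] vanishes on the
boundary, [U] is continuous with [0 <= U <= F <= L], and [U] is a viscosity
subsolution on the whole space: outside [Omega] it is at its minimum, so that a
function touching it from above is critical there ([extension_subsolution]).
The supersolution property holds up to the boundary
([extension_supersolution]). In both, quadratic test functions suffice.

Semiconcavity is obtained by tripling the variables: one maximizes
<<
  U (y + v + h) + U (y + v - h) - 2 U y - |v|^2 / eps - K(y) |h|^2 .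
>>
At a maximum the outer points carry the gradients [a = v / eps + K h] and
[b = v / eps - K h]; the central point carries their mean, corrected by a
multiple of [|h|^2 DK]. Subtracting the three viscosity inequalities bounds the
second difference of [U] by that of [F], minus the convexity defect
[|a|^p + |b|^p - 2 |(a + b) / 2|^p], plus the effect of the correction. The
subsolution inequalities also bound [v / eps] and [K h] by [L], so that [v]
tends to zero with [eps] and uniform continuity of [F] absorbs the difference
between [y] and [y + v].

When [F] is semiconcave with constant [c], the choice [K = c] already gives the
result, with the same constant, since the convexity defect is nonnegative
([global_semiconcavity]). In general one works in a ball of radius [r] inside
[Omega] and takes [K = C / w], where [w] vanishes on the sphere and is
comparable to the distance to it. The bound [K |h| <= L] gives [|h| <= w / 4], so
that only values of [F] in the ball enter. The correction costs a multiple of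
[C |h|^2 / w^2]; as [p <= 2], the p-th power of the norm is uniformly convex on
bounded sets and the defect is at least a multiple of [K^2 |h|^2], that is, of
[C^2 |h|^2 / w^2], which is larger once [C] is large. This yields the constant
[C / r] at the centre of the ball ([interior_semiconcavity]). Finally [d] is
Lipschitz on bounded sets and nonpositive outside [Omega], so [r] can be taken
proportional to [d x] ([positive_part_bound]). *)

(** * Euclidean geometry of row vectors *)

Section Euclidean.
Variables (R : realType) (n : nat).
Implicit Types (x y z : 'rV[R]_n) (a r : R).

Definition dot x y : R := \sum_(i < n) x ord0 i * y ord0 i.

Lemma dotC x y : dot x y = dot y x.
Proof. by apply: eq_bigr => i _; rewrite mulrC. Qed.

Lemma dotDl x y z : dot (x + y) z = dot x z + dot y z.
Proof. by rewrite -big_split; apply: eq_bigr => i _; rewrite mxE mulrDl. Qed.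

Lemma dotDr x y z : dot z (x + y) = dot z x + dot z y.
Proof. by rewrite dotC dotDl !(dotC z). Qed.

Lemma dotZl a x y : dot (a *: x) y = a * dot x y.
Proof. by rewrite mulr_sumr; apply: eq_bigr => i _; rewrite mxE mulrA. Qed.

Lemma dotZr a x y : dot x (a *: y) = a * dot x y.
Proof. by rewrite dotC dotZl dotC. Qed.

Lemma dotNl x y : dot (- x) y = - dot x y.
Proof. by rewrite -scaleN1r dotZl mulN1r. Qed.

Lemma dotNr x y : dot x (- y) = - dot x y.
Proof. by rewrite dotC dotNl dotC. Qed.

Lemma dot0l x : dot 0 x = 0.
Proof. by rewrite -(scale0r 0) dotZl mul0r. Qed.

Lemma dot0r x : dot x 0 = 0.
Proof. by rewrite dotC dot0l. Qed.

Definition dotE := (dotDl, dotDr, dotNl, dotNr, dotZl, dotZr, dot0l, dot0r).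

Lemma enorm_sqr x : enorm x ^+ 2 = dot x x.
Proof.
rewrite /enorm sqr_sqrtr; first by apply: eq_bigr => i _; rewrite expr2.
by apply: sumr_ge0 => i _; rewrite sqr_ge0.
Qed.

Lemma enorm_ge0 x : 0 <= enorm x.
Proof. exact: sqrtr_ge0. Qed.

Lemma dot_ge0 x : 0 <= dot x x.
Proof. by rewrite -enorm_sqr sqr_ge0. Qed.

Lemma coord_le_enorm x i : `|x ord0 i| <= enorm x.
Proof.
rewrite -sqrtr_sqr ler_sqrt; last by apply: sumr_ge0 => j _; exact: sqr_ge0.
by rewrite (bigD1 i) //= lerDl; apply: sumr_ge0 => j _; exact: sqr_ge0.
Qed.

Lemma norm_le_enorm x : `|x| <= enorm x.
Proof.
rewrite [`|x|]mx_normrE; apply/bigmax_leP; split => /=; first exact: enorm_ge0.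
by move=> [i j] _ /=; rewrite (ord1 i); exact: coord_le_enorm.
Qed.

Lemma enorm0 : enorm (0 : 'rV[R]_n) = 0.
Proof. by apply/eqP; rewrite -sqrf_eq0 enorm_sqr dot0l. Qed.

Lemma enorm_eq0 x : enorm x = 0 -> x = 0.
Proof.
by move=> x0; apply/eqP; rewrite -normr_eq0 eq_le normr_ge0 andbT -x0 norm_le_enorm.
Qed.

Lemma enormZ a x : enorm (a *: x) = `|a| * enorm x.
Proof.
apply/eqP; rewrite -(eqrXn2 (n := 2)) ?mulr_ge0 ?enorm_ge0//.
by rewrite exprMn !enorm_sqr !dotE real_normK ?num_real// expr2 mulrA.
Qed.

Lemma enormN x : enorm (- x) = enorm x.
Proof. by rewrite -scaleN1r enormZ normrN1 mul1r. Qed.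

Lemma enormBC x y : enorm (x - y) = enorm (y - x).
Proof. by rewrite -enormN opprB. Qed.

Lemma cauchy_schwarz x y : dot x y <= enorm x * enorm y.
Proof.
have [y0|y_neq0] := eqVneq (enorm y) 0.
  by rewrite (enorm_eq0 y0) dot0r enorm0 mulr0.
have y_gt0 : 0 < dot y y by rewrite -enorm_sqr exprn_gt0// lt0r y_neq0 enorm_ge0.
rewrite (le_trans (ler_norm _))// -(ler_pXn2r (n := 2)) ?nnegrE ?mulr_ge0 ?enorm_ge0//.
rewrite exprMn real_normK ?num_real// !enorm_sqr.
have := dot_ge0 (dot y y *: x - dot x y *: y).
rewrite !dotE (dotC y x).
rewrite (_ : _ + _ = dot y y * (dot x x * dot y y - dot x y ^+ 2)); last by ring.
by rewrite pmulr_rge0// subr_ge0.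
Qed.

Lemma enormD x y : enorm (x + y) <= enorm x + enorm y.
Proof.
rewrite -(ler_pXn2r (n := 2)) ?nnegrE ?addr_ge0 ?enorm_ge0//.
rewrite sqrrD !enorm_sqr !dotE (dotC y x).
have := cauchy_schwarz x y; lra.
Qed.

Lemma enormB x y : enorm (x - y) <= enorm x + enorm y.
Proof. by rewrite -(enormN y) enormD. Qed.

Lemma dist_enorm x y : `|enorm x - enorm y| <= enorm (x - y).
Proof.
have := enormD (x - y) y; have := enormD (y - x) x.
rewrite !subrK (enormBC y x) ler_norml; lra.
Qed.

End Euclidean.

Lemma continuous_sum (R : realType) (T : topologicalType) (I : Type)
    (s : seq I) (g : I -> T -> R) :
  (forall i, continuous (g i)) -> continuous (fun y => \sum_(i <- s) g i y).
Proof.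
move=> cg; elim: s => [|i s IHs].
  by rewrite (_ : (fun _ => _) = cst 0); [exact: cst_continuous|
    apply/funext => y; rewrite big_nil].
rewrite (_ : (fun _ => _) = g i \+ (fun y => \sum_(j <- s) g j y)).
  by move=> y; apply: cvgD; [exact: cg | exact: IHs].
by apply/funext => y; rewrite big_cons.
Qed.

Section EuclideanTopology.
Variables (R : realType) (n : nat).
Implicit Types (x y : 'rV[R]_n) (r : R).

Lemma enorm_continuous : continuous (@enorm R n).
Proof.
move=> x; apply: (continuous_comp (g := @Num.sqrt R)); last exact: sqrt_continuous.
apply: continuous_sum => i y.
exact: (cvgM (@coord_continuous R 1 n ord0 i y)
             (@coord_continuous R 1 n ord0 i y)).
Qed.

Lemma translation_continuous (g : 'rV[R]_n -> R) x :
  continuous g -> continuous (fun y => g (y - x)).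
Proof.
move=> cg y; apply: (continuous_comp (f := fun y => y - x)); last exact: cg.
exact: (cvgB cvg_id (cvg_cst _)).
Qed.

Lemma enorm_sub_continuous x : continuous (fun y => enorm (y - x)).
Proof. exact/translation_continuous/enorm_continuous. Qed.

Lemma near_enorm_lt x r : 0 < r -> \forall y \near x, enorm (y - x) < r.
Proof.
move=> r0.
have c : {for x, continuous (fun y => enorm (y - x))}.
  exact: enorm_sub_continuous.
move: c => /cvgr_lt; apply.
by rewrite subrr enorm0.
Qed.

Lemma nearP_enorm x (P : 'rV[R]_n -> Prop) :
  (\forall y \near x, P y) <->
  exists2 r, 0 < r & forall y, enorm (y - x) < r -> P y.
Proof.
split=> [/nbhs_ballP[r /= r0 rP]|[r r0 rP]].
  exists r => // y xy; apply: rP.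
  rewrite -ball_normE /ball_ /=; apply: le_lt_trans xy.
  by rewrite -normrN opprB norm_le_enorm.
by apply: filterS (near_enorm_lt x r0) => y; exact: rP.
Qed.

Lemma open_enormP (A : set 'rV[R]_n) x : open A -> A x ->
  exists2 r, 0 < r & forall y, enorm (y - x) <= r -> A y.
Proof.
move=> oA Ax; have /nearP_enorm[r r0 rA] : nbhs x A by exact: open_nbhs_nbhs.
exists (r / 2); first by rewrite divr_gt0.
move=> y yx; apply: rA; apply: le_lt_trans yx _; lra.
Qed.

Lemma closed_enorm_ball x r : closed [set y | enorm (y - x) <= r].
Proof.
apply: (@preimage_closed _ _ (fun y => enorm (y - x)) [set t | t <= r]).
  by move=> y _; exact: enorm_sub_continuous.
exact: closed_le.
Qed.

Lemma compact_enorm_ball x r : compact [set y | enorm (y - x) <= r].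
Proof.
apply: bounded_closed_compact; last exact: closed_enorm_ball.
exists (r + `|x|); split; first exact: num_real.
move=> M rM y /= yx; apply: le_trans (ltW rM).
rewrite -[y](subrK x); apply: le_trans (ler_normD _ _) _.
by rewrite lerD2r (le_trans (norm_le_enorm _)).
Qed.

End EuclideanTopology.

(** * Quantitative convexity of the p-th power of the Euclidean norm *)

Section PowerConvexity.
Variable R : realType.
Implicit Types (p s t L : R).

Lemma powR_le_tangent s t : 0 < s -> s <= 1 -> 0 <= t -> t `^ s <= 1 + s * (t - 1).
Proof.
move=> s0 s1 t0; have [->|s_neq1] := eqVneq s 1; first by rewrite powRr1//; lra.
have s_lt1 : s < 1 by rewrite lt_neqAle s_neq1.
have s1B : 0 < 1 - s by rewrite subr_gt0.
have := @conjugate_powR R (t `^ s) 1 s^-1 (1 - s)^-1 (powR_ge0 _ _) ler01.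
rewrite !invr_gt0 !invrK powR1 -powRrM divff ?gt_eqF// powRr1// mulr1 mul1r.
by move=> /(_ s0 s1B); rewrite subrKC => /(_ erefl); lra.
Qed.

(** Concavity of the power [s] at [t^-1] gives [t `^ s >= t / (s + (1 - s) t)],
hence [t `^ (1 + s) >= t^2 / (s + (1 - s) t)]. This rational function exceeds
its tangent line at 1 by [s^2 (t - 1)^2 / (s + (1 - s) t)], and the denominator
is at most 2. *)
Lemma powR_ge_quadratic s t : 0 < s -> s <= 1 -> 0 <= t -> t <= 2 ->
  1 + (1 + s) * (t - 1) + s ^+ 2 / 2 * (t - 1) ^+ 2 <= t `^ (1 + s).
Proof.
move=> s0 s1 t0 t2; have [->|t_neq0] := eqVneq t 0.
  by rewrite powR0 ?gt_eqF ?addr_gt0//; nra.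
have {}t0 : 0 < t by rewrite lt_neqAle eq_sym t_neq0.
have D0 : 0 < s + (1 - s) * t by nra.
have D2 : s + (1 - s) * t <= 2 by nra.
have tV : t^-1 `^ s <= (s + (1 - s) * t) / t.
  have -> : (s + (1 - s) * t) / t = 1 + s * (t^-1 - 1) by field.
  by apply: powR_le_tangent => //; rewrite invr_ge0 ltW.
have ts : t / (s + (1 - s) * t) <= t `^ s.
  rewrite -[t `^ s]invrK -powRN -invf_div lef_pV2 ?posrE ?divr_gt0 ?powR_gt0//.
  by rewrite powRN -powR_inv1 ?powR_ge0// -powRrM mulrC powRrM powR_inv1// ltW.
have -> : t `^ (1 + s) = t * t `^ s.
  by rewrite powRD ?powRr1 ?(ltW t0)// t_neq0 implybT.
apply: le_trans (ler_wpM2l (ltW t0) ts).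
rewrite [t * (t / _)]mulrA ler_pdivlMr// -subr_ge0.
rewrite (_ : _ - _ = s ^+ 2 / 2 * (t - 1) ^+ 2 * (2 - (s + (1 - s) * t))).
  by apply: mulr_ge0; [rewrite mulr_ge0 ?divr_ge0 ?sqr_ge0 | rewrite subr_ge0].
by field.
Qed.

Variables (n : nat).
Implicit Types a b : 'rV[R]_n.

(** The factor [L `^ p / L ^+ 2] comes from scaling the case [L = 1]: for
[X <= L] and [p <= 2] one has [X `^ p >= L `^ p * (X / L) ^+ 2]. *)
Definition convexity_modulus p L := (p - 1) ^+ 2 / 4 * (L `^ p / L ^+ 2).

Lemma convexity_modulus_gt0 p L : 1 < p -> 0 < L -> 0 < convexity_modulus p L.
Proof.
move=> p1 L0.
by rewrite !mulr_gt0 ?invr_gt0 ?exprn_gt0 ?powR_gt0 ?subr_gt0.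
Qed.

(** Write [A], [B] for the norms and [X] for their mean. By the parallelogram law
the midpoint has squared norm [X^2 - (|a - b|^2 - (A - B)^2) / 4]. The radial part
[(A - B)^2] is gained from strict convexity of the power on the half-line, the
remaining tangential part from the midpoint being shorter than [X]. *)
Lemma enorm_powR_strictly_convex p L a b :
    1 < p -> p <= 2 -> 0 < L -> enorm a <= L -> enorm b <= L ->
  convexity_modulus p L * enorm (a - b) ^+ 2
    <= enorm a `^ p + enorm b `^ p - 2 * enorm (2^-1 *: (a + b)) `^ p.
Proof.
move=> p1 p2 L0 aL bL.
have a0 := enorm_ge0 a; have b0 := enorm_ge0 b.
set A := enorm a in a0 aL *; set B := enorm b in b0 bL *.
have [X XE] : exists X, X = (A + B) / 2 by eexists.
have X0 : 0 <= X by rewrite XE divr_ge0// addr_ge0.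
have AB : `|A - B| <= enorm (a - b) by exact: dist_enorm.
have parallelogram :
    enorm (2^-1 *: (a + b)) ^+ 2
      = X ^+ 2 - (enorm (a - b) ^+ 2 - (A - B) ^+ 2) / 4.
  have aa : A ^+ 2 = dot a a by exact: enorm_sqr.
  have bb : B ^+ 2 = dot b b by exact: enorm_sqr.
  transitivity ((A ^+ 2 + B ^+ 2) / 2 - enorm (a - b) ^+ 2 / 4); last first.
    by rewrite XE; field.
  by rewrite aa bb !enorm_sqr !dotE (dotC b a); field.
set D := enorm (a - b) in AB parallelogram *.
set m := enorm (_ *: _) in parallelogram *.
have m0 : 0 <= m by exact: enorm_ge0.
have ABD : (A - B) ^+ 2 <= D ^+ 2.
  by rewrite -[(A - B) ^+ 2]real_normK ?num_real// ler_pXn2r ?nnegrE// enorm_ge0.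
have [X_eq0|X_neq0] := eqVneq X 0.
  have [A_eq0 B_eq0] : A = 0 /\ B = 0 by split; lra.
  have m_eq0 : m = 0 by rewrite X_eq0 A_eq0 B_eq0 in parallelogram; nra.
  have D_eq0 : D ^+ 2 = 0.
    by rewrite m_eq0 X_eq0 A_eq0 B_eq0 in parallelogram; nra.
  rewrite D_eq0 mulr0 m_eq0 A_eq0 B_eq0 powR0 ?gt_eqF ?(lt_trans ltr01)//; lra.
have {}X0 : 0 < X by rewrite lt_neqAle eq_sym X_neq0.
have XL : X <= L by lra.
have p0 : 0 <= p by lra.
have mX : m <= X.
  rewrite -(ler_pXn2r (n := 2)) ?nnegrE ?(ltW X0)// parallelogram; lra.
pose y := (A - B) / 2 / X.
have AX : A = X * (1 + y) by rewrite /y mulrDr mulr1 [X * _]mulrC divfK// XE; field.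
have BX : B = X * (1 - y) by rewrite /y mulrBr mulr1 [X * _]mulrC divfK// XE; field.
have y1 : 0 <= 1 + y by rewrite -(pmulr_rge0 _ X0) -AX.
have y2 : 0 <= 1 - y by rewrite -(pmulr_rge0 _ X0) -BX.
have pE : p = 1 + (p - 1) by ring.
have quadA : 1 + p * y + (p - 1) ^+ 2 / 2 * y ^+ 2 <= (1 + y) `^ p.
  have := @powR_ge_quadratic (p - 1) (1 + y); rewrite -pE.
  rewrite (_ : 1 + y - 1 = y); last by ring.
  by apply; lra.
have quadB : 1 - p * y + (p - 1) ^+ 2 / 2 * y ^+ 2 <= (1 - y) `^ p.
  have := @powR_ge_quadratic (p - 1) (1 - y); rewrite -pE.
  rewrite (_ : 1 - y - 1 = - y); last by ring.
  by rewrite sqrrN mulrN; apply; lra.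
have mp : m `^ p <= X `^ p * (m / X).
  have -> : m `^ p = X `^ p * (m / X) `^ p.
    by rewrite -powRM ?divr_ge0 ?(ltW X0)// (mulrC X) divfK.
  rewrite ler_wpM2l ?powR_ge0//.
  have [->|m_neq0] := eqVneq m 0.
    by rewrite mul0r powR0 ?gt_eqF ?(lt_trans ltr01).
  have m_gt0 : 0 < m by rewrite lt0r m_neq0.
  apply: ge1r_powR; last exact: ltW.
  by rewrite divr_gt0//= ler_pdivrMr// mul1r.
pose E := (D ^+ 2 - (A - B) ^+ 2) / 4 / X ^+ 2.
have mX1 : m / X <= 1 - E / 2.
  have mXE : (m / X) ^+ 2 = 1 - E.
    by rewrite expr_div_n parallelogram /E; field.
  have mX0 : 0 <= m / X by rewrite divr_ge0// ltW.
  have E0 : 0 <= E.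
    by rewrite !divr_ge0 ?sqr_ge0// subr_ge0.
  have E1 : E <= 1 by rewrite -subr_ge0 -mXE sqr_ge0.
  rewrite -(ler_pXn2r (n := 2)) ?nnegrE//; last by lra.
  rewrite mXE; nra.
have XpL : L `^ p * (X / L) ^+ 2 <= X `^ p.
  have -> : X `^ p = L `^ p * (X / L) `^ p.
    by rewrite -powRM ?divr_ge0 ?(ltW X0) ?(ltW L0)// (mulrC L) divfK// gt_eqF.
  rewrite ler_wpM2l ?powR_ge0// -powR_mulrn ?divr_ge0 ?(ltW X0) ?(ltW L0)//.
  apply: ger_powR => //.
  by rewrite divr_gt0//= ler_pdivrMr// mul1r.
rewrite {1}AX {1}BX !powRM ?(ltW X0)//.
set P := X `^ p in mp XpL *.
have P0 : 0 <= P by exact: powR_ge0.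
have q1 : (p - 1) ^+ 2 <= 1 by nra.
apply: (@le_trans _ _ (P * ((p - 1) ^+ 2 / 4 * (D ^+ 2 / X ^+ 2)))).
  rewrite /convexity_modulus.
  rewrite (_ : P * _ = (p - 1) ^+ 2 / 4 * (P * (D ^+ 2 / X ^+ 2))); last by ring.
  rewrite -mulrA ler_wpM2l ?divr_ge0 ?sqr_ge0//.
  rewrite (_ : L `^ p / L ^+ 2 * D ^+ 2
    = (L `^ p * (X / L) ^+ 2) * (D ^+ 2 / X ^+ 2)); last first.
    by field; rewrite X_neq0 gt_eqF.
  by rewrite ler_wpM2r// divr_ge0 ?sqr_ge0.
apply: (@le_trans _ _ (P * (2 + (p - 1) ^+ 2 * y ^+ 2) - 2 * (P * (1 - E / 2)))).
  rewrite (_ : P * (2 + _) - _ = P * ((p - 1) ^+ 2 * y ^+ 2 + E)); last by field.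
  rewrite ler_wpM2l//.
  rewrite (_ : D ^+ 2 / X ^+ 2 = 4 * y ^+ 2 + 4 * E); last first.
    by rewrite /y /E; field.
  have E0 : 0 <= E by rewrite !divr_ge0 ?sqr_ge0// subr_ge0.
  nra.
have mp' : m `^ p <= P * (1 - E / 2) by apply: le_trans mp _; rewrite ler_wpM2l.
have := ler_wpM2l P0 quadA; have := ler_wpM2l P0 quadB; lra.
Qed.

Lemma enorm_powR_midpoint p a b : 1 < p -> p <= 2 ->
  2 * enorm (2^-1 *: (a + b)) `^ p <= enorm a `^ p + enorm b `^ p.
Proof.
move=> p1 p2; rewrite -subr_ge0.
have a0 := enorm_ge0 a; have b0 := enorm_ge0 b.
have L0 : 0 < 1 + enorm a + enorm b by lra.
apply: le_trans (enorm_powR_strictly_convex p1 p2 L0 _ _); [|lra|lra].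
by rewrite mulr_ge0 ?sqr_ge0 ?ltW// convexity_modulus_gt0.
Qed.

(** The tangent line of the power function at [enorm a] lies below its graph. *)
Lemma enorm_powR_lipschitz p L a b : 1 < p -> p <= 2 -> enorm a <= L ->
  enorm a `^ p <= enorm b `^ p + p * L `^ (p - 1) * enorm (a - b).
Proof.
move=> p1 p2 aL.
have a0 := enorm_ge0 a; have b0 := enorm_ge0 b.
have p0 : 0 <= p by lra.
have C0 : 0 <= p * L `^ (p - 1) by rewrite mulr_ge0 ?powR_ge0.
have [ab|ba] := leP (enorm a) (enorm b).
  rewrite -[leLHS]addr0; apply: lerD; first exact: ge0_ler_powR.
  by rewrite mulr_ge0 ?enorm_ge0.
have a_gt0 : 0 < enorm a by exact: le_lt_trans b0 ba.
have a_neq0 := lt0r_neq0 a_gt0.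
have t0 : 0 <= enorm b / enorm a by rewrite divr_ge0.
have t1 : enorm b / enorm a <= 1 by rewrite ler_pdivrMr// mul1r ltW.
have := @powR_ge_quadratic (p - 1) (enorm b / enorm a).
rewrite subrKC => /(_ _ _ t0 _) tangent.
have {tangent} : 1 + p * (enorm b / enorm a - 1) <= (enorm b / enorm a) `^ p.
  apply: le_trans (tangent _ _ _); [|lra|lra|lra].
  by rewrite lerDl mulr_ge0 ?divr_ge0 ?sqr_ge0.
move=> /(ler_wpM2l (powR_ge0 (enorm a) p)).
rewrite -powRM// (mulrC (enorm a)) divfK// => tangent.
have ab : enorm a - enorm b <= enorm (a - b).
  by rewrite (le_trans (ler_norm _))// dist_enorm.
have : p * enorm a `^ (p - 1) * (enorm a - enorm b) <= p * L `^ (p - 1) * enorm (a - b).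
  rewrite ler_pM ?mulr_ge0 ?powR_ge0 ?subr_ge0 ?(ltW ba)// ler_wpM2l//.
  by apply: ge0_ler_powR; rewrite ?nnegrE//; lra.
have -> : enorm a `^ (p - 1) = enorm a `^ p / enorm a.
  by rewrite -(@mulr_powRB1 _ (enorm a) p)//; [field | lra].
rewrite (_ : p * _ * _ = enorm a `^ p * p * (1 - enorm b / enorm a)).
  by nra.
by field.
Qed.

End PowerConvexity.

(** * Quadratic test functions *)

Section Quadratic.
Variables (R : realType) (n : nat).
Implicit Types (q x y : 'rV[R]_n) (N : R).

Definition quadratic q N x y : R := dot q (y - x) + N * dot (y - x) (y - x).

Lemma quadratic_base q N x : quadratic q N x x = 0.
Proof. by rewrite /quadratic subrr !dot0r mulr0 addr0. Qed.

Lemma dot_continuous q : continuous (dot q).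
Proof.
apply: continuous_sum => i y.
exact: (cvgM (cvg_cst _) (@coord_continuous R 1 n ord0 i y)).
Qed.

Lemma quadratic_continuous q N x : continuous (quadratic q N x).
Proof.
have c1 : continuous (fun y => dot q (y - x)).
  exact/translation_continuous/dot_continuous.
have c2 : continuous (fun y => dot (y - x) (y - x)).
  rewrite (_ : (fun y => _) = (fun y => enorm (y - x) ^+ 2)); last first.
    by apply/funext => z; rewrite enorm_sqr.
  move=> y; exact: (cvgM (@enorm_sub_continuous R n x y) (@enorm_sub_continuous R n x y)).
by move=> y; exact: (cvgD (c1 y) (cvgM (cvg_cst N) (c2 y))).
Qed.

Lemma dot_delta q i : dot q (delta_mx ord0 i) = q ord0 i.
Proof.
rewrite /dot (bigD1 i)//= big1 ?addr0 => [|j ji]; rewrite mxE eqxx ?eqxx ?mulr1//.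
by rewrite (negPf ji) mulr0.
Qed.

Lemma quadratic_is_derive q N x y i :
  is_derive y (delta_mx ord0 i) (quadratic q N x)
    (q ord0 i + 2 * N * (y - x) ord0 i).
Proof.
set l := (X in is_derive _ _ _ X).
suff H : (fun h : R => h^-1 *: ((quadratic q N x \o shift y) (h *: delta_mx ord0 i)
    - quadratic q N x y)) @ 0^' --> l.
  by apply: DeriveDef; [apply: cvgP H | exact: cvg_lim H].
have H : (fun h : R => l + N * h) @ 0^' --> l.
  rewrite -[X in _ --> X]addr0 -[X in _ + X](mulr0 N).
  apply: cvgD; first exact: cvg_cst.
  by apply: cvgM; [exact: cvg_cst | exact: nbhs_dnbhs].
apply: cvg_trans H; apply: near_eq_cvg.
near=> h.
have h0 : h != 0 by near: h; exact: nbhs_dnbhs_neq.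
rewrite /= /quadratic [_ *: (_ - _)]/GRing.scale/= -(addrA _ y) !dotE.
rewrite !(dotC (delta_mx _ _)) !dot_delta !(mxE, dotE) eqxx/=.
by rewrite /l !mxE (dotC x y) !eqxx /=; field.
Unshelve. all: by end_near.
Qed.

Lemma gradient_quadratic q N x y :
  gradient (quadratic q N x) y = q + (2 * N) *: (y - x).
Proof.
apply/rowP => i; rewrite !mxE /pderiv.
by have := quadratic_is_derive q N x y i => -[_ ->]; rewrite !mxE.
Qed.

Lemma gradient_quadratic_base q N x : gradient (quadratic q N x) x = q.
Proof. by rewrite gradient_quadratic subrr scaler0 addr0. Qed.

Lemma gradient_quadratic_continuous q N x :
  continuous (gradient (quadratic q N x)).
Proof.
rewrite (funext (gradient_quadratic q N x)) => y.
exact: (cvgD (cvg_cst q) (cvgZ (cvg_cst (2 * N)) (cvgB cvg_id (cvg_cst x)))).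
Qed.

Lemma quadratic_Ck1 q N x (A : set 'rV[R]_n) : Ck 1 A (quadratic q N x).
Proof.
split=> [y _|i]; first exact: quadratic_continuous.
split=> [y _|]; first by have [] := quadratic_is_derive q N x y i.
split=> // y _.
rewrite (_ : pderiv i _ = (fun z => z ord0 i) \o gradient (quadratic q N x)).
  exact: (continuous_comp (@gradient_quadratic_continuous q N x y)
                          (@coord_continuous R 1 n ord0 i _)).
by apply/funext => z /=; rewrite mxE.
Qed.

(** These functions are smooth on the whole space, so they are admissible in
both halves of the definition of a solution. *)
Lemma quadratic_C1_closure q N x (A : set 'rV[R]_n) :
  C1_closure A (quadratic q N x) (gradient (quadratic q N x)).
Proof.
split=> //; [|exact: quadratic_Ck1|]; apply: continuous_subspaceT => y.
  exact: quadratic_continuous.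
exact: gradient_quadratic_continuous.
Qed.

End Quadratic.

(** * Compactness *)

(** The pairs of points of a large ball at which [g] differs by at least [e] form a
compact set; half of the least distance between the points of such a pair, or 1 if
smaller, is a suitable [eta]. *)
Lemma compact_support_uniformly_continuous (R : realType) (n : nat)
    (g : 'rV[R]_n -> R) (B e : R) :
    continuous g -> (forall x, B < enorm x -> g x = 0) -> 0 < e ->
  exists2 eta, 0 < eta & forall x y, enorm (x - y) <= eta -> `|g x - g y| <= e.
Proof.
move=> cg gB e0.
pose T := ('rV[R]_n * 'rV[R]_n)%type.
pose K : set 'rV[R]_n := [set y | enorm (y - 0) <= B + 1].
pose S : set T := [set z | e <= `|g z.1 - g z.2|].
have cS : compact (K `*` K `&` S).
  apply: (@subclosed_compact _ _ (K `*` K)); last by move=> z [].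
    apply: closedI.
      rewrite (_ : K `*` K = fst @^-1` K `&` snd @^-1` K)//.
      apply: closedI; apply: preimage_closed => [z _|];
        [exact: cvg_fst|exact: closed_enorm_ball|exact: cvg_snd|
         exact: closed_enorm_ball].
    apply: (@preimage_closed _ _ (fun z : T => `|g z.1 - g z.2|) [set t | e <= t]).
      move=> z _; apply: cvg_norm; apply: cvgB.
        by apply: (continuous_comp (f := fst)); [exact: cvg_fst|exact: cg].
      by apply: (continuous_comp (f := snd)); [exact: cvg_snd|exact: cg].
    exact: closed_ge.
  by apply: compact_setX; exact: compact_enorm_ball.
have big x y : enorm (x - y) <= 1 -> B + 1 < enorm x -> g x = 0 /\ g y = 0.
  move=> xy xB; split; apply: gB; first lra.
  have := enormD (x - y) y; rewrite subrK; lra.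
have small x y eta : 0 < eta -> eta <= 1 ->
    (forall z, (K `*` K `&` S) z -> eta < enorm (z.1 - z.2)) ->
    enorm (x - y) <= eta -> `|g x - g y| <= e.
  move=> eta0 eta1 min xy; rewrite leNgt; apply/negP => gxy.
  have xy1 : enorm (x - y) <= 1 by exact: le_trans eta1.
  have yx1 : enorm (y - x) <= 1 by rewrite enormBC.
  have [xB|/(big _ _ xy1)[gx gy]] := leP (enorm x) (B + 1); last first.
    by move: gxy; rewrite gx gy subrr normr0; lra.
  have [yB|/(big _ _ yx1)[gy gx]] := leP (enorm y) (B + 1); last first.
    by move: gxy; rewrite gx gy subrr normr0; lra.
  suff /min : (K `*` K `&` S) (x, y) by rewrite ltNge xy.
  by split; [split; rewrite /K /= subr0 | rewrite /S /= ltW].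
have [S0|/set0P/negP/negPn/eqP S0] := pselect (K `*` K `&` S !=set0); last first.
  by exists 1 => // x y; apply: small => //; rewrite S0.
have cd : continuous (fun z : T => enorm (z.1 - z.2)).
  move=> z; apply: (continuous_comp (f := fun z : T => z.1 - z.2)).
    exact: (cvgB cvg_fst cvg_snd).
  exact: enorm_continuous.
have [z zS min] := compact_EVT_min S0 cS (continuous_subspaceT cd).
have z0 : 0 < enorm (z.1 - z.2).
  rewrite lt0r enorm_ge0 andbT; apply/negP => /eqP/enorm_eq0/subr0_eq z12.
  move: zS; rewrite inE => -[_]; rewrite /S/= z12 subrr normr0; lra.
exists (Num.min 1 (enorm (z.1 - z.2) / 2)); first by rewrite lt_min ltr01 divr_gt0.
move=> x y; apply: small; [by rewrite lt_min ltr01 divr_gt0|by rewrite ge_min lexx|].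
move=> w wS; apply: (lt_le_trans _ (min w _)); last by rewrite inE.
by rewrite gt_min; apply/orP; right; lra.
Qed.

(** * Extension by zero *)

Section ZeroExtension.
Variables (R : realType) (n : nat).
Implicit Types (A : set 'rV[R]_n) (g : 'rV[R]_n -> R) (x y : 'rV[R]_n).

Lemma within_continuous_enorm A g x e :
    {within A, continuous g} -> A x -> 0 < e ->
  exists2 r, 0 < r &
    forall y, A y -> enorm (y - x) < r -> `|g x - g y| < e.
Proof.
move=> cg Ax e0; have /cvgrPdist_lt/(_ e e0) := cg x.
move=> near_x.
have /nearP_enorm[r r0 rP] : within A (nbhs x) [set y | `|g x - g y| < e].
  by rewrite nbhs_subspace_in.
by exists r => // y Ay yx; exact: rP.
Qed.

Lemma continuous_enormP g x :
    (forall e, 0 < e -> exists2 r, 0 < r &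
       forall y, enorm (y - x) < r -> `|g x - g y| < e) ->
  {for x, continuous g}.
Proof.
move=> gP; suff : g @ x --> g x by [].
apply/(@cvgrPdist_lt _ _ _ (nbhs x) (nbhs_filter x)) => e /gP[r r0 rP].
by apply/nearP_enorm; exists r.
Qed.

Lemma within_closure_continuous A g x :
  open A -> {within closure A, continuous g} -> A x -> {for x, continuous g}.
Proof.
move=> oA cg Ax; apply: continuous_enormP => e e0.
have [r r0 rP] := within_continuous_enorm cg (subset_closure Ax) e0.
have [s s0 sA] := open_enormP oA Ax.
exists (Num.min r s); first by rewrite lt_min r0.
move=> y; rewrite lt_min => /andP[yr ys]; apply: rP => //.
exact/subset_closure/sA/ltW.
Qed.

Lemma zero_extension_in A g x : A x -> zero_extension A g x = g x.
Proof. by move=> Ax; rewrite /zero_extension mem_set. Qed.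

Lemma zero_extension_out A g x : ~ A x -> zero_extension A g x = 0.
Proof. by move=> Ax; rewrite /zero_extension memNset. Qed.

Lemma zero_extension_closure A g x :
    open A -> (forall y, boundary A y -> g y = 0) -> closure A x ->
  zero_extension A g x = g x.
Proof.
move=> oA g0 clx; have [Ax|nAx] := pselect (A x); first exact: zero_extension_in.
rewrite zero_extension_out// g0//; split=> //.
by move=> /interior_subset.
Qed.

Lemma zero_extension_continuous A g :
    open A -> {within closure A, continuous g} ->
    (forall y, boundary A y -> g y = 0) ->
  continuous (zero_extension A g).
Proof.
move=> oA cg g0 x; apply: continuous_enormP => e e0.
have [clx|nclx] := pselect (closure A x); last first.
  have [r r0 rP] := open_enormP (closed_openC (@closed_closure _ A)) nclx.
  exists r => // y /ltW/rP ncly.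
  by rewrite !zero_extension_out ?subrr ?normr0// => /subset_closure.
have [r r0 rP] := within_continuous_enorm cg clx e0.
have [Ax|nAx] := pselect (A x).
  have [s s0 sA] := open_enormP oA Ax.
  exists (Num.min r s); first by rewrite lt_min r0.
  move=> y; rewrite lt_min => /andP[yr /ltW/sA Ay].
  by rewrite !zero_extension_in//; apply: rP => //; exact: subset_closure.
exists r => // y yr.
have [Ay|nAy] := pselect (A y); last first.
  by rewrite !zero_extension_out// subrr normr0.
rewrite zero_extension_closure// zero_extension_in//.
by apply: rP => //; exact: subset_closure.
Qed.

End ZeroExtension.

(** * The Hamilton-Jacobi equation *)

Section Solution.
Variables (R : realType) (n : nat) (p : R).
Variables (Omega : set 'rV[R]_n) (f u : 'rV[R]_n -> R).
Hypothesis p_gt0 : 0 < p.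
Hypothesis Omega_open : open Omega.
Hypothesis Omega_bounded : bounded_set Omega.
Hypothesis f_cont : {within closure Omega, continuous f}.
Hypothesis f_ge0 : forall x, closure Omega x -> 0 <= f x.
Hypothesis f_boundary : forall x, boundary Omega x -> f x = 0.
Hypothesis u_sol : PDE0 p Omega f u.

Let u_cont : {within closure Omega, continuous u}.
Proof. by case: u_sol. Qed.

Let u_sub : viscosity_subsolution p Omega f u.
Proof. by case: u_sol. Qed.

Let u_super : viscosity_supersolution_closure p Omega f u.
Proof. by case: u_sol. Qed.

Lemma compact_closure : compact (closure Omega).
Proof.
apply: bounded_closed_compact; last exact: closed_closure.
have [M [Mreal MO]] := Omega_bounded; exists M; split=> // M' MM' x clx.
have cM : closed [set y : 'rV[R]_n | `|y| <= M'].
  apply: (@preimage_closed _ _ (fun y : 'rV[R]_n => `|y|) [set t | t <= M']).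
    by move=> y _; exact: norm_continuous.
  exact: closed_le.
by apply: cM; apply: closureS clx => y Oy; exact: MO.
Qed.

Lemma solution_ge0 x : closure Omega x -> 0 <= u x.
Proof.
move=> clx.
have [x0 + min] := compact_EVT_min (ex_intro _ x clx) compact_closure u_cont.
rewrite inE => clx0.
have := u_super (quadratic_C1_closure 0 0 x0 Omega) clx0.
rewrite gradient_quadratic_base enorm0 powR0 ?gt_eqF// addr0 subr_ge0.
move=> super; apply: le_trans (min x _); last by rewrite inE.
apply: le_trans (f_ge0 clx0) (super _) => y cly.
by rewrite /quadratic !dotE !mul0r !addr0 !subr0 min// inE.
Qed.

(** If [f < u] near [x], the paraboloid [N |y - x|^2] with large [N], up to a
constant, touches [u] from above at a point near [x], where the subsolution
inequality gives [u <= f]. *)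
Lemma solution_le_inside x : Omega x -> u x <= f x.
Proof.
move=> Ox; rewrite leNgt; apply/negP => fu.
pose e := (u x - f x) / 2.
have e0 : 0 < e by rewrite divr_gt0// subr_gt0.
have clx := subset_closure Ox.
have [r1 r10 uP] := within_continuous_enorm u_cont clx e0.
have [r2 r20 fP] := within_continuous_enorm f_cont clx e0.
have [r3 r30 OP] := open_enormP Omega_open Ox.
pose r := Num.min (r1 / 2) (Num.min (r2 / 2) r3).
have r0 : 0 < r by rewrite !lt_min r30 !divr_gt0.
have rP y : enorm (y - x) <= r ->
    [/\ Omega y, `|u x - u y| < e & `|f x - f y| < e].
  rewrite !le_min => /andP[yr1 /andP[yr2 yr3]]; have Oy := OP _ yr3.
  by split=> //; [apply: uP|apply: fP]; try (exact: subset_closure); lra.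
pose N := 2 * e / r ^+ 2.
pose phi := quadratic 0 N x.
pose B : set 'rV[R]_n := [set y | enorm (y - x) <= r].
have cB : {within B, continuous (fun y => u y - phi y)}.
  apply: continuous_in_subspaceT => y; rewrite inE => /rP[Oy _ _].
  have uy := within_closure_continuous Omega_open u_cont Oy.
  exact: (cvgB uy (@quadratic_continuous _ _ 0 N x y)).
have Bx : B x by rewrite /B/= subrr enorm0 ltW.
have [y + max] := compact_EVT_max (ex_intro _ x Bx) (@compact_enorm_ball _ _ x r) cB.
rewrite inE => By; have [Oy uy fy] := rP _ By.
have yr : enorm (y - x) < r.
  have := max x; rewrite inE => /(_ Bx).
  rewrite /phi quadratic_base /quadratic dot0l add0r -enorm_sqr => uxy.
  have : N * enorm (y - x) ^+ 2 < e by move: uy; rewrite ltr_norml; lra.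
  rewrite /N mulrAC ltr_pdivrMr ?exprn_gt0// => H.
  rewrite -(ltr_pXn2r (n := 2)) ?nnegrE ?enorm_ge0 ?(ltW r0)//.
  have := sqr_ge0 (enorm (y - x)); nra.
have : u y + enorm (gradient phi y) `^ p - f y <= 0.
  apply: u_sub => //; first exact: quadratic_Ck1.
  apply/nearP_enorm; exists (r - enorm (y - x)); first by rewrite subr_gt0.
  move=> z zy; apply: max; rewrite inE /B/=.
  have := enormD (z - y) (y - x); rewrite addrA subrK; lra.
have := powR_ge0 (enorm (gradient phi y)) p.
move: uy fy; rewrite !ltr_norml /e; lra.
Qed.

Lemma solution_le x : closure Omega x -> u x <= f x.
Proof.
move=> clx; rewrite leNgt; apply/negP => fu.
pose e := (u x - f x) / 2.
have e0 : 0 < e by rewrite divr_gt0// subr_gt0.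
have [r1 r10 uP] := within_continuous_enorm u_cont clx e0.
have [r2 r20 fP] := within_continuous_enorm f_cont clx e0.
have r0 : 0 < Num.min r1 r2 by rewrite lt_min r10.
have [y [Oy]] := clx _ (near_enorm_lt x r0).
rewrite /= lt_min => /andP[yr1 yr2]; have cly := subset_closure Oy.
have := solution_le_inside Oy; have := uP _ cly yr1; have := fP _ cly yr2.
rewrite !ltr_norml /e; lra.
Qed.

Lemma solution_boundary x : boundary Omega x -> u x = 0.
Proof.
move=> bx; have [clx _] := bx; apply/eqP; rewrite eq_le solution_ge0// andbT.
by rewrite -(f_boundary bx) solution_le.
Qed.

Let U := zero_extension Omega u.
Let F := zero_extension Omega f.

Lemma extension_ge0 x : 0 <= U x.
Proof.
have [Ox|Ox] := pselect (Omega x); last by rewrite /U zero_extension_out.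
by rewrite /U zero_extension_in// solution_ge0//; exact: subset_closure.
Qed.

Lemma extension_le x : U x <= F x.
Proof.
have [Ox|Ox] := pselect (Omega x); last by rewrite /U /F !zero_extension_out.
by rewrite /U /F !zero_extension_in// solution_le_inside.
Qed.

Lemma datum_bounded : exists2 L, 1 <= L & forall x, F x <= L.
Proof.
have [[x clx]|O0] := pselect (closure Omega !=set0); last first.
  exists 1 => // x; rewrite /F zero_extension_out// => Ox.
  by apply: O0; exists x; exact: subset_closure.
have [y _ max] := compact_EVT_max (ex_intro _ x clx) compact_closure f_cont.
exists (Num.max 1 (f y)) => [|z]; first by rewrite le_max lexx.
rewrite le_max /F; have [Oz|Oz] := pselect (Omega z); last first.
  by rewrite zero_extension_out// ler01.
rewrite zero_extension_in//; apply/orP; right; apply: max.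
by rewrite inE; exact: subset_closure.
Qed.

(** At a point outside [Omega], [U] takes its minimal value 0, so a quadratic
function touching it from above has zero gradient there. *)
Lemma extension_subsolution x q N :
    (forall y, U y <= U x + quadratic q N x y) ->
  U x + enorm q `^ p <= F x.
Proof.
move=> touch; have [Ox|nOx] := pselect (Omega x).
  have := @u_sub (quadratic q N x) x (quadratic_Ck1 q N x Omega) Ox.
  rewrite gradient_quadratic_base /U /F !zero_extension_in// subr_le0; apply.
  have [r r0 rO] := open_enormP Omega_open Ox.
  apply/nearP_enorm; exists r => // y /ltW/rO Oy.
  have := touch y; rewrite /U !zero_extension_in// quadratic_base; lra.
have Ux : U x = 0 by rewrite /U zero_extension_out.
suff -> : q = 0 by rewrite Ux /F zero_extension_out// enorm0 powR0 ?gt_eqF ?addr0.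
apply: enorm_eq0; apply/eqP; rewrite -sqrf_eq0 enorm_sqr.
rewrite eq_le dot_ge0 andbT leNgt; apply/negP => q0.
(* Moving from [x] by [- t q] changes the test function by
   [- t |q|^2 (1 - N t)], which is negative for this [t]. *)
pose t := (2 * (1 + `|N|))^-1.
have t0 : 0 < t by rewrite invr_gt0 mulr_gt0// ltr_wpDr.
have Nt : N * t <= 2^-1.
  have : `|N| * t <= 2^-1.
    rewrite /t invfM mulrCA mulrC -[leRHS]mul1r ler_wpM2r// ler_pdivrMr ?ltr_wpDr//.
    by rewrite mul1r lerDr.
  apply: le_trans; rewrite ler_wpM2r ?ler_norm// ltW//.
have := touch (x - t *: q); have := extension_ge0 (x - t *: q).
rewrite Ux add0r /quadratic addrAC subrr add0r !dotE => U0 /(le_trans U0).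
rewrite (_ : _ + _ = t * dot q q * (N * t - 1)); last by ring.
by rewrite pmulr_rge0 ?mulr_gt0//; lra.
Qed.

(** The definition of a supersolution tests against functions that touch [u] from
below on the whole closure. As [u] is nonnegative, touching near [x] becomes
touching everywhere once the quadratic coefficient is sufficiently negative. *)
Lemma extension_supersolution x q N :
    closure Omega x ->
    (\forall y \near x, closure Omega y -> U x + quadratic q N x y <= U y) ->
  F x <= U x + enorm q `^ p.
Proof.
move=> clx /nearP_enorm[r r0 touch].
pose N' := - (`|N| + enorm q / r + U x / r ^+ 2).
have Ucl y : closure Omega y -> U y = u y.
  exact: (zero_extension_closure Omega_open solution_boundary).
have -> : F x = f x by exact: zero_extension_closure.
have := u_super (quadratic_C1_closure q N' x Omega) clx.
rewrite gradient_quadratic_base subr_ge0 Ucl//; apply => y cly.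
rewrite quadratic_base subr0 -!Ucl// lerBrDr.
set v := enorm (y - x).
have qv : dot q (y - x) <= enorm q * v by exact: cauchy_schwarz.
have Ux0 := extension_ge0 x; have Uy0 := extension_ge0 y; have q0 := enorm_ge0 q.
have v0 : 0 <= v by exact: enorm_ge0.
have c1 : 0 <= enorm q / r by rewrite divr_ge0// ltW.
have c2 : 0 <= U x / r ^+ 2 by rewrite divr_ge0// sqr_ge0.
have [vr|rv] := ltP v r.
  apply: le_trans (touch _ vr cly); rewrite /quadratic -enorm_sqr -/v.
  rewrite lerD2l lerD2l ler_wpM2r ?sqr_ge0// /N'.
  have := ler_norm (- N); rewrite normrN; lra.
suff : U x + quadratic q N' x y <= 0 by lra.
rewrite /quadratic -enorm_sqr -/v /N' mulNr !mulrDl.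
have H1 : enorm q * v <= enorm q / r * v ^+ 2.
  rewrite -mulrA ler_wpM2l// ler_pdivlMl// mulrC expr2 ler_wpM2l//.
have H2 : U x <= U x / r ^+ 2 * v ^+ 2.
  rewrite -[leLHS]mulr1 -mulrA ler_wpM2l// ler_pdivlMl ?exprn_gt0// mulr1.
  by rewrite ler_pXn2r ?nnegrE// ltW.
have H3 : 0 <= `|N| * v ^+ 2 by rewrite mulr_ge0 ?sqr_ge0.
lra.
Qed.

End Solution.

(** * A barrier blowing up on a sphere *)

Section Barrier.
Variables (R : realType) (n : nat) (x0 : 'rV[R]_n) (r w0 C : R).
Hypotheses (r_gt0 : 0 < r) (w0_gt0 : 0 < w0) (w0_le : w0 <= r) (C_gt0 : 0 < C).
Implicit Types x y : 'rV[R]_n.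

(** Up to a factor 2, the distance from [y] to the sphere of radius [r] centred
at [x0], for [y] in the ball; as a polynomial it has explicit increments. *)
Definition depth y : R := r - enorm (y - x0) ^+ 2 / r.

(** The cut-off at [w0] keeps the function continuous on the whole space; it is
inactive where [depth] exceeds [w0]. *)
Definition barrier y : R := C / Num.max (depth y) w0.

Lemma barrier_denominator_gt0 y : 0 < Num.max (depth y) w0.
Proof. by rewrite lt_max w0_gt0 orbT. Qed.

Lemma depth_le y : depth y <= r.
Proof. by rewrite lerBlDr lerDl divr_ge0 ?sqr_ge0// ltW. Qed.

Lemma depth_center : depth x0 = r.
Proof. by rewrite /depth subrr enorm0 expr0n mul0r subr0. Qed.

Lemma barrier_ge y : C / r <= barrier y.
Proof.
rewrite /barrier ler_wpM2l ?(ltW C_gt0)// lef_pV2 ?posrE ?barrier_denominator_gt0//.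
by rewrite ge_max depth_le.
Qed.

Lemma barrier_center : barrier x0 = C / r.
Proof. by rewrite /barrier depth_center max_l. Qed.

Lemma barrier_continuous : continuous barrier.
Proof.
have cd : continuous depth.
  have ce := @enorm_sub_continuous R n x0.
  have ce2 : continuous (fun y => enorm (y - x0) ^+ 2).
    by move=> y; exact: (cvgM (ce y) (ce y)).
  by move=> y; exact: (cvgB (cvg_cst r) (cvgM (ce2 y) (cvg_cst r^-1))).
have cm : continuous (fun y => Num.max (depth y) w0).
  by move=> y; apply: (@continuous_max _ _ depth (cst w0) y (cd y)); exact: cst_continuous.
have cV : continuous (fun y => (Num.max (depth y) w0)^-1).
  by move=> y; exact: (cvgV (lt0r_neq0 (barrier_denominator_gt0 y)) (cm y)).
by move=> y; exact: (cvgM (cvg_cst C) (cV y)).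
Qed.

Lemma depth_le_dist y : depth y <= 2 * (r - enorm (y - x0)).
Proof.
rewrite -(ler_pM2r r_gt0) /depth mulrBl divfK ?gt_eqF//.
have := sqr_ge0 (r - enorm (y - x0)); nra.
Qed.

(** With [w] and [W] the denominators at [y] and [y'], the identity
[1 / W = 1 / w + (w - W) / w^2 + (w - W)^2 / (w^2 W)] isolates the linear part of
the increment; [w - W] is at most [depth y - depth y'], which is explicit. *)
Lemma barrier_quadratic_upper_bound y y' :
    enorm (y - x0) <= r -> enorm (y' - x0) <= r -> w0 < depth y ->
  barrier y' <= barrier y
    + quadratic ((2 * C / (r * depth y ^+ 2)) *: (y - x0))
                (C / (r * depth y ^+ 2) + 16 * C / (depth y ^+ 2 * w0)) y y'.
Proof.
move=> yr y'r w0y; rewrite /barrier (max_l (ltW w0y)).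
set w := depth y in w0y *; set W := Num.max (depth y') w0.
have W0 : 0 < W by exact: barrier_denominator_gt0.
have w_gt0 : 0 < w by exact: lt_trans w0y.
have Ww0 : w0 <= W by rewrite le_max lexx orbT.
have Wy' : depth y' <= W by rewrite le_max lexx.
rewrite /quadratic dotZl.
have [d dE] : exists d, d = y' - y by eexists.
rewrite -dE; set s := 2 * dot (y - x0) d + dot d d.
have depth_diff : w - depth y' = s / r.
  rewrite /w /depth /s !enorm_sqr (_ : y' - x0 = (y - x0) + d); last first.
    by rewrite dE [RHS]addrC addrA subrK.
  by rewrite !dotE; rewrite !(dotC d); field; rewrite gt_eqF.
have d0 := enorm_ge0 d.
have d2r : enorm d <= 2 * r.
  rewrite (_ : d = (y' - x0) - (y - x0)); last first.
    by rewrite dE opprB addrA subrK.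
  by apply: le_trans (enormB _ _) _; lra.
have s_le : `|s| <= 4 * r * enorm d.
  have cs1 := cauchy_schwarz (y - x0) d; have cs2 := cauchy_schwarz (y - x0) (- d).
  rewrite dotNr enormN in cs2.
  have cs : enorm (y - x0) * enorm d <= r * enorm d by rewrite ler_wpM2r.
  have dd : dot d d <= 2 * r * enorm d by rewrite -enorm_sqr expr2 ler_wpM2r.
  have := dot_ge0 d; rewrite ler_norml /s => dd0; apply/andP; split; lra.
have wW_le : w - W <= s / r by lra.
have wW_sqr : (w - W) ^+ 2 <= 16 * dot d d.
  have : `|w - W| <= `|s / r|.
    rewrite -depth_diff /W; case: (leP w0 (depth y')) => // y'w0.
    rewrite !ger0_norm; lra.
  rewrite normrM (gtr0_norm (x := r^-1)) ?invr_gt0// => H.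
  have : `|w - W| <= 4 * enorm d.
    by apply: le_trans H _; rewrite ler_pdivrMr// mulrAC.
  rewrite -(ler_pXn2r (n := 2)) ?nnegrE ?mulr_ge0// real_normK ?num_real//.
  by rewrite exprMn enorm_sqr; lra.
have -> : C / W = C / w + C / w ^+ 2 * (w - W) + C / (w ^+ 2 * W) * (w - W) ^+ 2.
  by field; rewrite !gt_eqF.
have H1 : C / w ^+ 2 * (w - W) <= C / w ^+ 2 * (s / r).
  by rewrite ler_wpM2l ?divr_ge0 ?sqr_ge0 ?(ltW C_gt0).
have H2 : C / (w ^+ 2 * W) * (w - W) ^+ 2 <= C / (w ^+ 2 * w0) * (16 * dot d d).
  apply: ler_pM => //; [|exact: sqr_ge0|].
    apply: divr_ge0; first exact: ltW.
    by apply: mulr_ge0; [exact: sqr_ge0 | exact: ltW].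
  rewrite ler_wpM2l ?(ltW C_gt0)// lef_pV2 ?posrE ?mulr_gt0 ?exprn_gt0//.
  by apply: ler_wpM2l => //; exact: sqr_ge0.
rewrite (_ : _ + (_ + _) = C / w + C / w ^+ 2 * (s / r)
   + C / (w ^+ 2 * w0) * (16 * dot d d)); last first.
  by rewrite /s; field; rewrite !gt_eqF.
by rewrite lerD// lerD2l.
Qed.

End Barrier.

(** * Tripling of variables *)

Lemma half_sum_eq (R : realType) (n : nat) (x y : 'rV[R]_n) :
  2^-1 *: (x + y + (x - y)) = x.
Proof.
rewrite addrACA subrr addr0 scalerDr -scalerDl.
by rewrite (_ : 2^-1 + 2^-1 = 1) ?scale1r//; field.
Qed.

Lemma half_diff_eq (R : realType) (n : nat) (x y : 'rV[R]_n) :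
  2^-1 *: (x + y + (y - x)) = y.
Proof. by rewrite (addrC x) half_sum_eq. Qed.

Section ThreePoints.
Variables (R : realType) (n : nat) (p L : R).
Variables (A : set 'rV[R]_n) (F U : 'rV[R]_n -> R).
Implicit Types (x y v h q : 'rV[R]_n) (eps N : R) (K : 'rV[R]_n -> R).
Hypothesis p_gt1 : 1 < p.
Hypothesis p_le2 : p <= 2.
Hypothesis L_ge1 : 1 <= L.
Hypothesis U_cont : continuous U.
Hypothesis U_ge0 : forall x, 0 <= U x.
Hypothesis U_le : forall x, U x <= F x.
Hypothesis F_le : forall x, F x <= L.
Hypothesis subsolution : forall x q N,
  (forall y, U y <= U x + quadratic q N x y) -> U x + enorm q `^ p <= F x.
Hypothesis supersolution : forall x q N, A x ->
  (\forall y \near x, A y -> U x + quadratic q N x y <= U y) ->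
  F x <= U x + enorm q `^ p.

Let L_gt0 : 0 < L. Proof. exact: lt_le_trans L_ge1. Qed.

(** The outer points are [y + v + h] and [y + v - h]. The variable [v] separates their
midpoint from [y], so that all three points can be varied independently. *)
Definition three_point eps K y v h : R :=
  U (y + v + h) + U (y + v - h) - 2 * U y - dot v v / eps - K y * dot h h.

Lemma three_point_center eps K y h :
  three_point eps K y 0 h = U (y + h) + U (y - h) - 2 * U y - K y * dot h h.
Proof. by rewrite /three_point addr0 dot0l mul0r subr0. Qed.

Lemma three_point_le eps K y v h :
  three_point eps K y v h <= 2 * L - dot v v / eps - K y * dot h h.
Proof.
rewrite /three_point; have := U_ge0 y.
have := le_trans (U_le (y + v + h)) (F_le _).
have := le_trans (U_le (y + v - h)) (F_le _); lra.
Qed.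

Lemma three_point_continuous eps K : continuous K ->
  continuous (fun z : 'rV[R]_n * ('rV[R]_n * 'rV[R]_n) =>
    three_point eps K z.1 z.2.1 z.2.2).
Proof.
move=> cK; pose T := ('rV[R]_n * ('rV[R]_n * 'rV[R]_n))%type.
have c1 : continuous (fun z : T => z.1) by move=> z; exact: cvg_fst.
have c2 : continuous (fun z : T => z.2.1).
  by move=> z; apply: (continuous_comp (f := snd)); [exact: cvg_snd|exact: cvg_fst].
have c3 : continuous (fun z : T => z.2.2).
  by move=> z; apply: (continuous_comp (f := snd)); [exact: cvg_snd|exact: cvg_snd].
have cdot (g : T -> 'rV[R]_n) : continuous g -> continuous (fun z => dot (g z) (g z)).
  move=> cg; rewrite (_ : (fun _ => _) = (fun z => enorm (g z) * enorm (g z))).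
    have ce : continuous (fun z => enorm (g z)).
      by move=> z; apply: continuous_comp; [exact: cg | exact: enorm_continuous].
    by move=> z; exact: (cvgM (ce z) (ce z)).
  by apply/funext => z; rewrite -expr2 enorm_sqr.
have cU (g : T -> 'rV[R]_n) : continuous g -> continuous (fun z => U (g z)).
  by move=> cg z; apply: continuous_comp; [exact: cg | exact: U_cont].
have cp : continuous (fun z : T => z.1 + z.2.1 + z.2.2).
  by move=> z; exact: (cvgD (cvgD (c1 z) (c2 z)) (c3 z)).
have cm : continuous (fun z : T => z.1 + z.2.1 - z.2.2).
  by move=> z; exact: (cvgB (cvgD (c1 z) (c2 z)) (c3 z)).
have cKz : continuous (fun z : T => K z.1).
  by move=> z; apply: continuous_comp; [exact: c1 | exact: cK].
have c4 : continuous (fun z : T =>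
    U (z.1 + z.2.1 + z.2.2) + U (z.1 + z.2.1 - z.2.2) - 2 * U z.1).
  have cUp := cU _ cp; have cUm := cU _ cm; have cUy := cU _ c1.
  have c2U : continuous (fun z : T => 2 * U z.1).
    by move=> z; exact: (cvgM (cvg_cst (2 : R)) (cUy z)).
  have cUU : continuous (fun z : T => U (z.1 + z.2.1 + z.2.2) + U (z.1 + z.2.1 - z.2.2)).
    by move=> z; exact: (cvgD (cUp z) (cUm z)).
  by move=> z; exact: (cvgB (cUU z) (c2U z)).
have c5 : continuous (fun z : T => dot z.2.1 z.2.1 / eps).
  by move=> z; exact: (cvgM (cdot _ c2 z) (cvg_cst eps^-1)).
have c6 : continuous (fun z : T => K z.1 * dot z.2.2 z.2.2).
  by move=> z; exact: (cvgM (cKz z) (cdot _ c3 z)).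
by move=> z; exact: (cvgB (cvgB (c4 z) (c5 z)) (c6 z)).
Qed.

(** Although [v] and [h] range over the whole space, the penalization makes the
function nonpositive outside a ball, and it vanishes at [v = h = 0]. *)
Lemma three_point_max eps K (Y : set 'rV[R]_n) (k : R) :
    0 < eps -> 0 < k -> continuous K -> (forall y, k <= K y) ->
    compact Y -> Y !=set0 ->
  exists y v h, Y y /\ forall y' v' h', Y y' ->
    three_point eps K y' v' h' <= three_point eps K y v h.
Proof.
move=> eps0 k0 cK kK cY [y0 Yy0].
pose rho := 1 + 2 * L * eps + 2 * L / k.
have rhov : 2 * L * eps <= rho ^+ 2.
  have : 0 <= 2 * L * eps by rewrite !mulr_ge0 ?ltW.
  have : 0 <= 2 * L / k by rewrite !mulr_ge0 ?invr_ge0 ?ltW.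
  rewrite /rho; nra.
have rhoh : 2 * L / k <= rho ^+ 2.
  have : 0 <= 2 * L * eps by rewrite !mulr_ge0 ?ltW.
  have : 0 <= 2 * L / k by rewrite !mulr_ge0 ?invr_ge0 ?ltW.
  rewrite /rho; nra.
have rho0 : 0 <= rho by rewrite /rho !addr_ge0// !mulr_ge0 ?invr_ge0 ?ltW.
pose B : set 'rV[R]_n := [set v | enorm (v - 0) <= rho].
pose S : set ('rV[R]_n * ('rV[R]_n * 'rV[R]_n)) := Y `*` (B `*` B).
have B0 : B 0 by rewrite /B/= subrr enorm0.
have S0 : S !=set0 by exists (y0, (0, 0)).
have cS : compact S.
  by apply: compact_setX => //; apply: compact_setX; exact: compact_enorm_ball.
have [[y [v h]] + max] := compact_EVT_max S0 cS
  (continuous_subspaceT (@three_point_continuous eps K cK)).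
rewrite inE => -[/= Yy _]; exists y, v, h; split=> // y' v' h' Yy'.
have max0 : 0 <= three_point eps K y v h.
  have := max (y0, (0, 0)); rewrite inE => /(_ (conj Yy0 (conj B0 B0))) /=.
  by rewrite three_point_center dot0l mulr0 !subr0 addr0; lra.
have [vB|vB] := leP (enorm v') rho; last first.
  apply: le_trans max0; apply: le_trans (three_point_le _ _ _ _ _) _.
  have : 2 * L <= dot v' v' / eps.
    rewrite ler_pdivlMr// (le_trans rhov)// -enorm_sqr ler_pXn2r ?nnegrE ?enorm_ge0//.
    exact: ltW.
  have : 0 <= K y' * dot h' h'.
    by rewrite mulr_ge0 ?dot_ge0// (le_trans _ (kK _))// ltW.
  lra.
have [hB|hB] := leP (enorm h') rho; last first.
  apply: le_trans max0; apply: le_trans (three_point_le _ _ _ _ _) _.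
  have : 0 <= dot v' v' / eps by rewrite divr_ge0 ?dot_ge0// ltW.
  have : 2 * L <= K y' * dot h' h'.
    apply: (@le_trans _ _ (k * dot h' h')); last by rewrite ler_wpM2r ?dot_ge0.
    rewrite (mulrC k) -ler_pdivrMr// (le_trans rhoh)//.
    by rewrite -enorm_sqr ler_pXn2r ?nnegrE ?enorm_ge0// ltW.
  lra.
by apply: (max (y', (v', h'))); rewrite inE; split=> //; split; rewrite /B/= subr0.
Qed.

(** Moving [y + v + h] by [w] while the two other points stay fixed changes both
[v] and [h] by [w / 2]. *)
Lemma three_point_subsolution_add eps K y v h : 0 < eps ->
    (forall v' h', three_point eps K y v' h' <= three_point eps K y v h) ->
  U (y + v + h) + enorm (eps^-1 *: v + K y *: h) `^ p <= F (y + v + h).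
Proof.
move=> eps0 max; have eps_neq0 := lt0r_neq0 eps0.
apply: (@subsolution _ _ ((eps^-1 + K y) / 4)) => x.
have [w wE] : exists w, w = x - (y + v + h) by eexists.
have := max (v + 2^-1 *: w) (h + 2^-1 *: w).
have half : 2^-1 *: w + 2^-1 *: w = w.
  by rewrite -scalerDl (_ : 2^-1 + 2^-1 = 1) ?scale1r//; field.
rewrite /three_point.
rewrite (_ : y + (v + 2^-1 *: w) + (h + 2^-1 *: w) = x); last first.
  by rewrite (addrA y) addrACA half wE addrC subrK.
rewrite (_ : y + (v + 2^-1 *: w) - (h + 2^-1 *: w) = y + v - h); last first.
  by rewrite opprD (addrA y) addrACA subrr addr0.
rewrite /quadratic -wE !dotE (dotC w v) (dotC w h).
set X := U x; set Y := U (y + v + h).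
have -> : (dot v v + 2^-1 * dot v w + (2^-1 * dot v w + 2^-1 * (2^-1 * dot w w))) / eps
   = dot v v / eps + eps^-1 * dot v w + eps^-1 * dot w w / 4 by field.
lra.
Qed.

Lemma three_pointN eps K y v h :
  three_point eps K y v (- h) = three_point eps K y v h.
Proof. by rewrite /three_point opprK dotNl dotNr opprK (addrC (U (_ - h))). Qed.

Lemma three_point_subsolution_sub eps K y v h : 0 < eps ->
    (forall v' h', three_point eps K y v' h' <= three_point eps K y v h) ->
  U (y + v - h) + enorm (eps^-1 *: v - K y *: h) `^ p <= F (y + v - h).
Proof.
move=> eps0 max; rewrite -scalerN; apply: three_point_subsolution_add => // v' h'.
by rewrite three_pointN.
Qed.

(** Here the outer points stay fixed while [y] moves to [y'], which turns [v] into
[y + v - y']. *)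
Lemma three_point_supersolution eps K y v h kappa N : 0 < eps -> A y ->
    (\forall y' \near y, A y' ->
       three_point eps K y' (y + v - y') h <= three_point eps K y v h) ->
    (\forall y' \near y, A y' -> K y' <= K y + quadratic kappa N y y') ->
  F y <= U y + enorm (eps^-1 *: v - (dot h h / 2) *: kappa) `^ p.
Proof.
move=> eps0 Ay max Kle; have eps_neq0 := lt0r_neq0 eps0.
apply: (@supersolution _ _ (- (eps^-1 + N * dot h h) / 2)) => //.
near=> y' => Ay'.
have : A y' -> three_point eps K y' (y + v - y') h <= three_point eps K y v h.
  by near: y'.
have : A y' -> K y' <= K y + quadratic kappa N y y' by near: y'.
move=> /(_ Ay') /(ler_wpM2r (dot_ge0 h)) Kyy' /(_ Ay').
rewrite /three_point (addrC y') subrK.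
have [w wE] : exists w, w = y' - y by eexists.
have -> : y + v - y' = v - w by rewrite wE opprB addrA (addrC y).
move: Kyy'; rewrite /quadratic -wE mulrDl !dotE (dotC w v).
have -> : (dot v v - dot v w + (- dot v w - - dot w w)) / eps
   = dot v v / eps - 2 * (eps^-1 * dot v w) + eps^-1 * dot w w by field.
set a := eps^-1 * dot v w; set b := eps^-1 * dot w w.
have -> : - (eps^-1 + N * dot h h) / 2 * dot w w
  = - b / 2 - N * dot w w * dot h h / 2 by rewrite /b; field.
lra.
Unshelve. all: by end_near.
Qed.

Lemma gradient_bound x q : U x + enorm q `^ p <= F x -> enorm q <= L.
Proof.
move=> sub; rewrite leNgt; apply/negP => Lq.
have : L <= L `^ p by rewrite le1r_powR// ltW.
have : L `^ p < enorm q `^ p.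
  by apply: gt0_ltr_powR; rewrite ?nnegrE ?enorm_ge0 ?(lt_trans ltr01) ?(ltW L_gt0).
have := U_ge0 x; have := F_le x; lra.
Qed.

Lemma enorm_half_sum x y : enorm x <= L -> enorm y <= L ->
  enorm (2^-1 *: (x + y)) <= L.
Proof.
move=> xL yL; rewrite enormZ ger0_norm ?invr_ge0// mulrC ler_pdivrMr//.
have := enormD x y; lra.
Qed.


Lemma three_point_subsolution eps K y v h : 0 < eps ->
    (forall v' h', three_point eps K y v' h' <= three_point eps K y v h) ->
  [/\ U (y + v + h) + enorm (eps^-1 *: v + K y *: h) `^ p <= F (y + v + h),
      U (y + v - h) + enorm (eps^-1 *: v - K y *: h) `^ p <= F (y + v - h),
      enorm v <= eps * L & `|K y| * enorm h <= L].
Proof.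
move=> eps0 max; have eps_neq0 := lt0r_neq0 eps0.
have sa := three_point_subsolution_add eps0 max.
have sb := three_point_subsolution_sub eps0 max.
have aL := gradient_bound sa; have bL := gradient_bound sb; split=> //.
  have := enorm_half_sum aL bL; rewrite half_sum_eq.
  by rewrite enormZ gtr0_norm ?invr_gt0// ler_pdivrMl.
rewrite -enormN in bL.
have := enorm_half_sum aL bL.
by rewrite opprB half_diff_eq enormZ.
Qed.

(** A constant [K] has no derivative, so the gradient at the central point is the
mean of the two others and convexity of the p-th power suffices. *)
Lemma global_semiconcavity c x h :
    compact A ->
    (forall e : R, 0 < e -> exists2 eta : R, 0 < eta &
       forall y z, enorm (y - z) <= eta -> `|F y - F z| <= e) ->
    0 < c ->
    (forall y g, F (y + g) - 2 * F y + F (y - g) <= c * enorm g ^+ 2) ->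
    A x ->
  U (x + h) - 2 * U x + U (x - h) <= c * enorm h ^+ 2.
Proof.
move=> cA F_ucont c0 F_sc Ax; rewrite leNgt; apply/negP.
set lhs := (X in _ < X) => gap.
pose sigma := lhs - c * enorm h ^+ 2.
have sigma0 : 0 < sigma by rewrite subr_gt0.
have [eta eta0 Feta] := F_ucont _ (divr_gt0 sigma0 (ltr0n _ 4)).
pose eps : R := eta / L.
have eps0 : 0 < eps by rewrite divr_gt0.
have [y [v [g [Ay max]]]] := three_point_max eps0 c0 (@cst_continuous _ _ c)
  (fun _ => lexx c) cA (ex_intro _ x Ax).
have [sa sb vL _] := three_point_subsolution eps0 (fun v' h' => max y v' h' Ay).
have super : F y <= U y + enorm (eps^-1 *: v - (dot g g / 2) *: 0) `^ p.
  apply: (@three_point_supersolution eps (cst c) y v g 0 0) => //.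
    by apply/nearP_enorm; exists 1 => // y' _; exact: max.
  by apply/nearP_enorm; exists 1 => // y' _ _; rewrite /quadratic dot0l mul0r !addr0.
have := enorm_powR_midpoint (eps^-1 *: v + c *: g) (eps^-1 *: v - c *: g) p_gt1 p_le2.
rewrite half_sum_eq; rewrite scaler0 subr0 in super => convex.
have := max x 0 h Ax; rewrite three_point_center -enorm_sqr => sigma_le.
have vv : 0 <= dot v v / eps by rewrite divr_ge0 ?dot_ge0// ltW.
have Fyv : `|F (y + v) - F y| <= sigma / 4.
  by apply: Feta; rewrite addrC addKr (le_trans vL)// /eps divfK// gt_eqF.
have := F_sc (y + v) g; rewrite enorm_sqr.
move: sigma_le; rewrite /three_point /cst.
move: sigma0 Fyv sa sb super convex; rewrite ler_norml /sigma /lhs /cst.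
move: (enorm (_ + _) `^ p) (enorm (_ - _) `^ p) (enorm (_ *: _) `^ p).
move: (U (x + h)) (U (x - h)) (U (y + v + g)) (U (y + v - g)) (dot v v / eps) vv.
move: (F (y + v + g)) (F (y + v - g)) (F (y + v)); clear.
move=> F1 F2 F3 U1 U2 U3 U4 t t0 a b m; lra.
Qed.


(** The constants [theta] and [Lam] stand for the uniform convexity and the
Lipschitz constant of the p-th power of the norm on the relevant balls. The
condition [Lam <= 2 theta C] makes the convexity gain [4 theta C^2 X] absorb the
loss [2 Lam C X] due to the derivative of the barrier, where
[X = |g|^2 / w^2]. *)
Lemma interior_semiconcavity theta Lam c C r x0 h :
    0 < c -> c <= C -> 4 * L <= C ->
    0 <= Lam -> Lam <= 2 * theta * C ->
    (forall a b : 'rV[R]_n, enorm a <= L -> enorm b <= L ->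
       theta * enorm (a - b) ^+ 2
         <= enorm a `^ p + enorm b `^ p - 2 * enorm (2^-1 *: (a + b)) `^ p) ->
    (forall a b : 'rV[R]_n, enorm a <= 2 * L ->
       enorm a `^ p <= enorm b `^ p + Lam * enorm (a - b)) ->
    0 < r -> r <= 1 ->
    (forall y, enorm (y - x0) <= r -> A y) ->
    (forall e : R, 0 < e -> exists2 eta : R, 0 < eta &
       forall y z, enorm (y - z) <= eta -> `|U y - U z| <= e) ->
    (forall e : R, 0 < e -> exists2 eta : R, 0 < eta &
       forall y z, enorm (y - z) <= eta -> `|F y - F z| <= e) ->
    (forall y g, A (y + g) -> A y -> A (y - g) ->
       F (y + g) - 2 * F y + F (y - g) <= c * enorm g ^+ 2) ->
  U (x0 + h) - 2 * U x0 + U (x0 - h) <= C / r * enorm h ^+ 2.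
Proof.
move=> c0 cC LC Lam0 LamC theta_convex Lam_lip r0 r1 ballA U_ucont F_ucont F_sc; rewrite leNgt; apply/negP.
set lhs := (X in _ < X) => gap.
pose sigma := lhs - C / r * enorm h ^+ 2.
have sigma0 : 0 < sigma by rewrite subr_gt0.
have C0 : 0 < C by exact: lt_le_trans cC.
have [etaU etaU0 Ueta] := U_ucont _ (divr_gt0 sigma0 (ltr0n _ 8)).
have [etaF etaF0 Feta] := F_ucont _ (divr_gt0 sigma0 (ltr0n _ 8)).
pose w0 : R := Num.min r (Num.min etaU etaF).
have w00 : 0 < w0 by rewrite !lt_min r0 etaU0.
have w0r : w0 <= r by rewrite ge_min lexx.
have w0U : w0 <= etaU by rewrite !ge_min lexx orbT.
have w0F : w0 <= etaF by rewrite !ge_min lexx !orbT.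
clearbody w0.
pose eps : R := w0 / (4 * L).
have eps0 : 0 < eps by rewrite divr_gt0 ?mulr_gt0.
pose K := barrier x0 r w0 C.
have kK y : C / r <= K y by exact: barrier_ge.
have k0 : 0 < C / r by rewrite divr_gt0.
have K0 y : 0 < K y by exact: lt_le_trans (kK y).
pose Y : set 'rV[R]_n := [set y | enorm (y - x0) <= r].
have Yx0 : Y x0 by rewrite /Y/= subrr enorm0 ltW.
have [y [v [g [Yy max]]]] := three_point_max eps0 k0
  (@barrier_continuous R n x0 r w0 C w00) kK
  (@compact_enorm_ball _ _ x0 r) (ex_intro _ x0 Yx0).
have opt := three_point_subsolution eps0 (fun v' h' => max y v' h' Yy).
have [_ _ vL gL] := opt.
rewrite (gtr0_norm (K0 y)) in gL.
have {}vL : enorm v <= w0 / 4.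
  by rewrite (_ : w0 / 4 = eps * L)// /eps; field; rewrite gt_eqF.
have sigma_le : sigma <= three_point eps K y v g.
  apply: le_trans (max x0 0 h Yx0); rewrite three_point_center -enorm_sqr.
  rewrite /K barrier_center// le_eqVlt; apply/orP; left; apply/eqP.
  by rewrite /sigma /lhs; ring.
clearbody eps; clearbody sigma; clear gap lhs.
have vv : 0 <= dot v v / eps by rewrite divr_ge0 ?dot_ge0// ltW.
have gg : 0 <= K y * dot g g by rewrite mulr_ge0 ?dot_ge0 ?(ltW (K0 y)).
(* Uniform continuity of [U] forbids three close points, and [C |g| / w <= L]
   then keeps [y] away from the sphere. *)
have g_gt : w0 / 4 < enorm g.
  rewrite ltNge; apply/negP => gw.
  have close z : enorm z <= enorm v + enorm g -> `|U (y + z) - U y| <= sigma / 8.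
    move=> zvg; apply: Ueta; rewrite addrC addKr.
    by move: zvg vL gw w0U w00; lra.
  have := close _ (enormD v g); have := close _ (enormB v g).
  rewrite !addrA !ler_norml; move: sigma_le; rewrite /three_point.
  move: vv gg sigma0.
  move: (U _) (U _) (U _) (_ / eps) (K y * _) => U1 U2 U3 t1 t2; lra.
pose w := depth x0 r y.
have w_gt0 : w0 < w /\ 4 * enorm g <= w.
  have : C * enorm g <= L * Num.max w w0.
    by rewrite -ler_pdivrMr ?barrier_denominator_gt0// mulrAC.
  have : 4 * L * enorm g <= C * enorm g by rewrite ler_wpM2r ?enorm_ge0.
  move=> H1 /(le_trans H1); rewrite (mulrC 4) -mulrA ler_pM2l//.
  have := enorm_ge0 g; move: g_gt w00.
  by have [ww|ww] := leP w w0 => *; split; lra.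
case: w_gt0 => w0w gw; have w_gt0 : 0 < w by exact: lt_trans w0w.
have KE : K y = C / w by rewrite /K /barrier max_l// ltW.
have yr : enorm (y - x0) < r by have := depth_le_dist x0 r0 y; rewrite -/w; move: w_gt0; lra.
pose kappa := (2 * C / (r * w ^+ 2)) *: (y - x0).
have super : F y <= U y + enorm (eps^-1 *: v - (dot g g / 2) *: kappa) `^ p.
  have near_Y y' : enorm (y' - y) < r - enorm (y - x0) -> Y y'.
    move=> y'y; rewrite /Y/=.
    have := enormD (y' - y) (y - x0); rewrite addrA subrK.
    by move: y'y; lra.
  apply: (@three_point_supersolution eps K y v g kappa
    (C / (r * w ^+ 2) + 16 * C / (w ^+ 2 * w0))) => //; first exact: ballA.
    apply/nearP_enorm; exists (r - enorm (y - x0)); first by rewrite subr_gt0.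
    by move=> y' /near_Y Yy' _; exact: max.
  apply/nearP_enorm; exists (r - enorm (y - x0)); first by rewrite subr_gt0.
  by move=> y' /near_Y Yy' _; exact: barrier_quadratic_upper_bound.
(* The derivative of the barrier perturbs the gradient at [y] by at most
   [C X <= L], which keeps it in the ball where [Lam] is a Lipschitz constant. *)
have [sa sb _ _] := opt; rewrite -/(K y) KE in sa sb.
set m := eps^-1 *: v in sa sb super.
have [a aE] : exists a, a = m + (C / w) *: g by eexists.
have [b bE] : exists b, b = m - (C / w) *: g by eexists.
rewrite -aE in sa; rewrite -bE in sb.
have [py pyE] : exists py, py = m - (dot g g / 2) *: kappa by eexists.
rewrite -pyE in super.
have aL := gradient_bound sa; have bL := gradient_bound sb.
have mE : 2^-1 *: (a + b) = m by rewrite aE bE half_sum_eq.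
have mL : enorm m <= L by rewrite -mE enorm_half_sum.
pose X := dot g g / w ^+ 2.
have X0 : 0 <= X by rewrite divr_ge0 ?dot_ge0 ?sqr_ge0.
have err : enorm (m - py) <= C * X.
  rewrite pyE opprB addrC subrK enormZ ger0_norm ?divr_ge0 ?dot_ge0//.
  rewrite /kappa enormZ ger0_norm; last first.
    by rewrite ltW// divr_gt0 ?mulr_gt0 ?exprn_gt0.
  rewrite (_ : _ * (_ * _) = C * X * (enorm (y - x0) / r)); last first.
    by rewrite /X; field; rewrite !gt_eqF.
  apply: ler_piMr; first by apply: mulr_ge0 => //; exact: ltW.
  by rewrite ler_pdivrMr// mul1r ltW.
have CX : C * X <= L.
  have gw4 : enorm g / w <= 1.
    by rewrite ler_pdivrMr// mul1r; have := enorm_ge0 g; move: gw; lra.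
  rewrite (_ : C * X = (K y * enorm g) * (enorm g / w)); last first.
    by rewrite KE /X -enorm_sqr; field; rewrite gt_eqF.
  apply: le_trans gL; apply: ler_piMr => //.
  by apply: mulr_ge0; [exact: ltW | exact: enorm_ge0].
have pyL : enorm py <= 2 * L.
  have := enormB m (m - py); rewrite opprB addrC subrK.
  by move: mL err CX; lra.
have lip := Lam_lip _ m pyL.
have strict := theta_convex _ _ aL bL.
have ab : enorm (a - b) ^+ 2 = 4 * C ^+ 2 * X.
  rewrite (_ : a - b = (2 * (C / w)) *: g); last first.
    by rewrite aE bE opprB addrC addrA subrK -scalerDl mulr_natl mulr2n.
  rewrite enormZ.
  rewrite exprMn real_normK ?num_real// /X enorm_sqr.
  by field; rewrite gt_eqF.
rewrite mE ab in strict.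
have gain : Lam * (C * X) <= 2 * theta * C * (C * X).
  by rewrite ler_wpM2r// mulr_ge0 ?(ltW C0).
have {}lip : enorm py `^ p <= enorm m `^ p + Lam * (C * X).
  apply: le_trans lip _; rewrite lerD2l ler_wpM2l ?(enormBC py)//.
(* The three points at which [F] is compared stay in the ball, because their
   distance to [y] is at most half of [w]. *)
have inball z : enorm z <= enorm v + enorm g -> A (y + z).
  move=> zvg; apply: ballA.
  have := enormD z (y - x0); rewrite addrA (addrC z).
  have := depth_le_dist x0 r0 y; rewrite -/w.
  by move: zvg vL gw w0w; lra.
have Ayp : A (y + v + g) by rewrite -addrA; exact/inball/enormD.
have Aym : A (y + v - g) by rewrite -addrA; exact/inball/enormB.
have Ayv : A (y + v) by apply: inball; rewrite lerDl enorm_ge0.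
have := F_sc _ _ Ayp Ayv Aym; rewrite enorm_sqr => Fsc.
have cK : c * dot g g <= K y * dot g g.
  rewrite ler_wpM2r ?dot_ge0// (le_trans cC)// (le_trans _ (kK y))//.
  by rewrite ler_pdivlMr// ler_piMr// ltW.
have Fyv : `|F (y + v) - F y| <= sigma / 8.
  apply: Feta; rewrite addrC addKr.
  by move: vL w0F w00; lra.
move: Fyv; rewrite ler_norml; move: sigma_le; rewrite /three_point.
move: sigma0 vv cK Fsc gain lip strict super sa sb; clear.
move: (enorm a `^ p) (enorm b `^ p) (enorm m `^ p) (enorm py `^ p).
move=> ap bp mp pp; move: (F (y + v + g)) (F (y + v - g)) (F (y + v)) (F y).
move: (U (y + v + g)) (U (y + v - g)) (U y) (dot v v / eps) (K y * dot g g).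
move: (c * dot g g) (Lam * _) theta sigma => s1 s2 th s.
move=> U1 U2 U3 t1 t2 F1 F2 F3 F4; lra.
Qed.

End ThreePoints.

(** * Lipschitz bounds for C^1 functions *)

Section C1Lipschitz.
Variables (R : realType) (n : nat) (d : 'rV[R]_n -> R).
Hypothesis d_C1 : Ck 1 [set: 'rV[R]_n] d.
Implicit Types (x y : 'rV[R]_n) (B M : R).

Let d_cont : continuous d.
Proof. by have [dc _] := d_C1; move=> x; exact: dc. Qed.

Let pderiv_cont i : continuous (pderiv i d).
Proof. by have [_ /(_ i)[_ [dc _]]] := d_C1; move=> x; exact: dc. Qed.

Let e i : 'rV[R]_n := delta_mx ord0 i.

Lemma line_is_derive x i (t : R) :
  is_derive t 1 (fun s : R => d (x + s *: e i)) (pderiv i d (x + t *: e i)).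
Proof.
have dv : derivable d (x + t *: e i) (e i).
  by have [_ /(_ i)[dd _]] := d_C1; exact: dd.
have same : (fun h : R => h^-1 *: (((fun s : R => d (x + s *: e i)) \o shift t) (h *: 1)
    - d (x + t *: e i))) = (fun h : R => h^-1 *: ((d \o shift (x + t *: e i)) (h *: e i)
    - d (x + t *: e i))).
  apply/funext => h /=; congr (_ *: (d _ - _)).
  by rewrite [h *: 1]mulr1 scalerDl addrCA.
by apply: DeriveDef; [rewrite /derivable same | rewrite /pderiv /derive same].
Qed.

Lemma line_continuous x i : continuous (fun s : R => d (x + s *: e i)).
Proof.
move=> s; apply: (continuous_comp (f := fun s : R => x + s *: e i)); last exact: d_cont.
exact: (cvgD (cvg_cst x) (cvgZ cvg_id (cvg_cst (e i)))).
Qed.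

Lemma line_increment x i M (s t : R) : s <= t ->
    (forall r, s <= r <= t -> `|pderiv i d (x + r *: e i)| <= M) ->
  `|d (x + t *: e i) - d (x + s *: e i)| <= M * (t - s).
Proof.
move=> st bound.
have [r + ->] := @MVT_segment R (fun r => d (x + r *: e i)) _ s t st
  (fun r _ => line_is_derive x i r)
  (continuous_subspaceT (@line_continuous x i)).
rewrite in_itv /= => rst; rewrite normrM (ger0_norm (x := t - s)) ?subr_ge0//.
by rewrite ler_wpM2r ?subr_ge0// bound.
Qed.

Definition box B : set 'rV[R]_n := [set x | forall i, `|x ord0 i| <= B].

Lemma compact_box B : compact (box B).
Proof.
rewrite (_ : box B = [set v | forall i, `[- B, B]%classic (v ord0 i)]).
  by apply: (@rV_compact _ _ (fun=> `[- B, B]%classic)) => _; exact: segment_compact.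
by apply/seteqP; split=> x /= xB i; have := xB i; rewrite ler_norml ?in_itv.
Qed.

Lemma pderiv_bounded_on_box B : exists2 M, 0 <= M &
  forall i x, box B x -> `|pderiv i d x| <= M.
Proof.
have bound i : exists2 M, 0 <= M & forall x, box B x -> `|pderiv i d x| <= M.
  have [[x Bx]|B0] := pselect (box B !=set0); last first.
    by exists 0 => // x Bx; case: B0; exists x.
  have cp : continuous (fun x => `|pderiv i d x|).
    by move=> y; apply: continuous_comp; [exact: pderiv_cont | exact: norm_continuous].
  have [y _ max] := compact_EVT_max (ex_intro _ x Bx) (@compact_box B)
    (continuous_subspaceT cp).
  by exists `|pderiv i d y| => // z Bz; apply: max; rewrite inE.
pose M i := sval (cid2 (bound i)).
have M0 i : 0 <= M i by rewrite /M; case: cid2.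
exists (\sum_i M i); first by apply: sumr_ge0.
move=> i x Bx; apply: (@le_trans _ _ (M i)).
  by rewrite /M; case: cid2 => /= m _; apply.
by rewrite (bigD1 i)//= lerDl sumr_ge0.
Qed.

(** The coordinates of [x] are replaced by those of [y] one at a time, so that only
partial derivatives are needed and the path stays in the box. *)
Let hybrid x y k : 'rV[R]_n := \row_i (if (i < k)%N then y ord0 i else x ord0 i).

Lemma C1_lipschitz_on_box B : exists2 M, 0 <= M &
  forall x y, box B x -> box B y -> `|d y - d x| <= M * enorm (y - x).
Proof.
have [M M0 bound] := pderiv_bounded_on_box B.
exists (n%:R * M); first by rewrite mulr_ge0.
move=> x y Bx By.
suff step k : (k <= n)%N -> `|d (hybrid x y k) - d x| <= k%:R * M * enorm (y - x).
  have := step n (leqnn n); congr (`|d _ - _| <= _).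
  by apply/rowP => i; rewrite mxE ltn_ord.
elim: k => [_|k IHk kn].
  rewrite (_ : hybrid x y 0 = x) ?subrr ?normr0 ?mul0r//.
  by apply/rowP => i; rewrite mxE.
pose i := Ordinal kn; pose t := y ord0 i - x ord0 i.
have hybridS : hybrid x y k.+1 = hybrid x y k + t *: e i.
  apply/rowP => j; rewrite !mxE eqxx/= ltnS leq_eqVlt.
  have [ji|ji] := eqVneq j i; last first.
    by rewrite mulr0 addr0 (_ : (j == k :> nat) = false)//; apply/negbTE.
  by rewrite ji eqxx/= ltnn mulr1 addrC subrK.
have line_in_box r : Num.min 0 t <= r <= Num.max 0 t ->
    box B (hybrid x y k + r *: e i).
  move=> rt j; rewrite !mxE eqxx/=.
  have [ji|ji] := eqVneq j i; last first.
    by rewrite mulr0 addr0; case: ifP => _; [exact: By | exact: Bx].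
  rewrite ji ltnn mulr1; move: (Bx i) (By i) rt; rewrite !ler_norml ge_min le_max /t.
  by case: (leP 0 (y ord0 i - x ord0 i)) => *; lra.
have inc : `|d (hybrid x y k.+1) - d (hybrid x y k)| <= M * `|t|.
  rewrite hybridS -[X in _ - d X]addr0 -[X in _ - d (_ + X)](scale0r (e i)).
  have [t0|t0] := leP 0 t.
    rewrite (ger0_norm t0) -[X in M * X]subr0; apply: line_increment => // r rt.
    by apply/bound/line_in_box; rewrite min_l// max_r.
  rewrite distrC (ltr0_norm t0) -[X in M * X]add0r.
  apply: line_increment; first exact: ltW.
  by move=> r rt; apply/bound/line_in_box; rewrite min_r ?max_l// ltW.
have tn : `|t| <= enorm (y - x).
  by have := coord_le_enorm (y - x) i; rewrite !mxE.
have {}inc := le_trans inc (ler_wpM2l M0 tn).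
have := ler_normD (d (hybrid x y k.+1) - d (hybrid x y k)) (d (hybrid x y k) - d x).
rewrite addrA subrK => /le_trans; apply.
rewrite -natr1 2!mulrDl mul1r addrC lerD// IHk//; exact: ltnW.
Qed.

Lemma le_norm_box x : box `|x| x.
Proof.
move=> i; rewrite [leRHS]mx_normrE.
by apply/bigmax_geP; right => /=; exists (ord0, i).
Qed.

(** Points [y] in a large box are handled by the Lipschitz bound and [d y <= 0];
points outside it are at distance at least 1 from [Omega]. *)
Lemma positive_part_bound (Omega : set 'rV[R]_n) :
    bounded_set Omega -> (forall x, ~ Omega x -> d x <= 0) ->
  exists2 Lam, 0 < Lam & forall x, Omega x ->
    d x <= Lam /\ forall y, ~ Omega y -> d x <= Lam * enorm (y - x).
Proof.
move=> [B [_ OB]] dout.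
pose B1 := `|B| + 1.
have B1B : B < B1 by rewrite (le_lt_trans (ler_norm B))// ltrDl.
have Obox x : Omega x -> `|x| <= B1 by move=> Ox; exact: OB Ox.
have boxW x B' : `|x| <= B' -> box B' x.
  by move=> xB i; apply: le_trans xB; exact: le_norm_box.
have [M M0 lip] := C1_lipschitz_on_box (B1 + 1).
have [D D0 dD] : exists2 D, 0 <= D & forall x, box (B1 + 1) x -> d x <= D.
  have B10 : box (B1 + 1) 0.
    by move=> i; rewrite mxE normr0 /B1; have := normr_ge0 B; lra.
  have [z _ max] := compact_EVT_max (ex_intro _ _ B10) (@compact_box (B1 + 1))
    (continuous_subspaceT d_cont).
  exists `|d z| => // x Bx; apply: le_trans (ler_norm _).
  by apply: max; rewrite inE.
have Obox1 x : Omega x -> box (B1 + 1) x.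
  by move=> /Obox xB; apply: boxW; apply: le_trans xB _; lra.
exists (M + D + 1); first by lra.
move=> x Ox; have dxD := dD _ (Obox1 _ Ox); split; first by lra.
move=> y nOy; have yx0 := enorm_ge0 (y - x).
have [yB|yB] := leP `|y| (B1 + 1).
  have := lip x y (Obox1 _ Ox) (boxW _ _ yB); have := dout _ nOy.
  rewrite ler_norml; nra.
have yx1 : 1 <= enorm (y - x).
  apply: le_trans (norm_le_enorm _).
  have := ler_normD (y - x) x; rewrite subrK; have := Obox _ Ox; lra.
nra.
Qed.

End C1Lipschitz.

(** * Semiconcavity of the solution *)

Lemma bounded_enorm (R : realType) (n : nat) (Omega : set 'rV[R]_n) :
  bounded_set Omega -> exists B, forall x, Omega x -> enorm x <= B.
Proof.
move=> bO; have [[x Ox]|O0] := pselect (Omega !=set0); last first.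
  by exists 0 => x Ox; case: O0; exists x.
have [z _ max] := compact_EVT_max (ex_intro _ x (subset_closure Ox))
  (compact_closure bO) (continuous_subspaceT (@enorm_continuous R n)).
by exists (enorm z) => y Oy; apply: max; rewrite inE; exact: subset_closure.
Qed.

Theorem theorem4p1 (R : realType) (n : nat) (p c : R)
    (Omega : set 'rV[R]_n.+1) (f u d : 'rV[R]_n.+1 -> R)
    (p_gt1 : 1 < p) (p_le2 : p <= 2)
    (Omega_open : open Omega) (Omega_bounded : bounded_set Omega)
    (Omega_connected : connected Omega) (Omega_C2 : C2_boundary Omega)
    (f_cont : {within closure Omega, continuous f})
    (f_W1infty : W1infty Omega f)
    (f_ge0 : forall x, closure Omega x -> 0 <= f x)
    (f_boundary : forall x, boundary Omega x -> f x = 0)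
    (f_semiconcave : semiconcave_with (closure Omega) c f)
    (u_sol : PDE0 p Omega f u)
    (d_ext : is_distance_extension Omega d) :
  (uniformly_semiconcave [set: 'rV[R]_n.+1] (zero_extension Omega f) ->
     uniformly_semiconcave (closure Omega) u) /\
  (locally_semiconcave Omega u /\
   exists C : R, 0 < C /\
     forall x, Omega x -> exists M : R, 0 < M /\
       forall h, enorm h <= M ->
         [/\ Omega (x + h), Omega (x - h)
           & u (x + h) - 2 * u x + u (x - h) <= C / d x * enorm h ^+ 2]).
Proof.
have p_gt0 : 0 < p by exact: lt_trans p_gt1.
pose F := zero_extension Omega f; pose U := zero_extension Omega u.
have u_boundary : forall x, boundary Omega x -> u x = 0.
  exact: solution_boundary u_sol.
have F_cont : continuous F by exact: zero_extension_continuous.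
have U_cont : continuous U by case: u_sol => *; exact: zero_extension_continuous.
have [L L_ge1 F_le] := datum_bounded Omega_bounded f_cont.
have U_ge0 : forall x, 0 <= U x by exact: extension_ge0 u_sol.
have U_le : forall x, U x <= F x by exact: extension_le u_sol.
have Ucl x : closure Omega x -> U x = u x by exact: zero_extension_closure.
have Fcl x : closure Omega x -> F x = f x by exact: zero_extension_closure.
have sub := @extension_subsolution R n.+1 p Omega f u p_gt0 Omega_open
  Omega_bounded f_ge0 u_sol.
have super := @extension_supersolution R n.+1 p Omega f u p_gt0 Omega_open
  Omega_bounded f_cont f_ge0 f_boundary u_sol.
have [B OB] := bounded_enorm Omega_bounded.
have vanish (g : 'rV[R]_n.+1 -> R) x : B < enorm x -> zero_extension Omega g x = 0.
  by move=> Bx; rewrite zero_extension_out// => /OB; rewrite leNgt Bx.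
have F_ucont (e : R) := @compact_support_uniformly_continuous R n.+1 F B e F_cont
  (vanish f).
have U_ucont (e : R) := @compact_support_uniformly_continuous R n.+1 U B e U_cont
  (vanish u).
split=> [[c' [c'0 F_sc]]|].
  exists c'; split=> // x h Oph Ox Omh.
  rewrite -!Ucl//; apply: (global_semiconcavity p_gt1 p_le2 L_ge1 U_cont U_ge0 U_le
    F_le sub super h (compact_closure Omega_bounded) F_ucont c'0 _ Ox).
  by move=> y g; exact: F_sc.
have [d_C2 _ d_pos d_npos] := d_ext.
have d_C1 : Ck 1 [set: 'rV[R]_n.+1] d.
  have [dc dd] := d_C2; split=> // i; have [ddi [dci _]] := dd i.
  by split=> //; split.
have [Lam Lam0 dLam] := positive_part_bound d_C1 Omega_bounded d_npos.
have [c0 f_sc] := f_semiconcave.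
have L0 : 0 < L by exact: lt_le_trans L_ge1.
pose theta := convexity_modulus p L.
have theta0 : 0 < theta by exact: convexity_modulus_gt0.
pose K := p * (2 * L) `^ (p - 1).
have K0 : 0 <= K by rewrite mulr_ge0 ?powR_ge0// ltW.
pose C := c + 4 * L + K / theta.
have Kt0 : 0 <= K / theta by rewrite divr_ge0// ltW.
have cC : c <= C by rewrite /C -addrA lerDl addr_ge0// mulr_ge0// ltW.
have LC : 4 * L <= C.
  by rewrite /C -addrA addrCA lerDl addr_ge0// ltW.
have C0 : 0 < C by exact: lt_le_trans cC.
have KC : K <= 2 * theta * C.
  have : K / theta <= C by rewrite /C lerDr addr_ge0 ?mulr_ge0 ?(ltW c0) ?(ltW L0).
  rewrite ler_pdivrMr// => /le_trans; apply.
  by rewrite mulrC ler_wpM2r ?(ltW C0)// ler_peMl ?(ltW theta0)// ler1n.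
have strict (a b : 'rV[R]_n.+1) := @enorm_powR_strictly_convex R n.+1 p L a b
  p_gt1 p_le2 L0.
have lip (a b : 'rV[R]_n.+1) := @enorm_powR_lipschitz R n.+1 p (2 * L) a b p_gt1 p_le2.
have ball x y : Omega x -> enorm (y - x) <= d x / (2 * Lam) -> Omega y.
  move=> Ox yx; have dx0 := d_pos _ Ox; have [_ dLamx] := dLam _ Ox.
  apply: contrapT => /dLamx; apply/negP; rewrite -ltNge.
  apply: (le_lt_trans (ler_wpM2l (ltW Lam0) yx)).
  rewrite (_ : Lam * _ = d x / 2); last by field; rewrite gt_eqF.
  by rewrite gtr_pMr// invf_lt1// ltr1n.
have interior x h : Omega x ->
    U (x + h) - 2 * U x + U (x - h) <= 2 * Lam * C / d x * enorm h ^+ 2.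
  move=> Ox; have dx0 := d_pos _ Ox; have [dxLam _] := dLam _ Ox.
  have r0 : 0 < d x / (2 * Lam) by rewrite divr_gt0// mulr_gt0.
  have r1 : d x / (2 * Lam) <= 1.
    by rewrite ler_pdivrMr ?mulr_gt0// mul1r; move: dxLam Lam0; clear; lra.
  have -> : 2 * Lam * C / d x = C / (d x / (2 * Lam)) by field; rewrite !gt_eqF.
  apply: (interior_semiconcavity p_gt1 L_ge1 U_cont U_ge0 U_le F_le sub super h
    c0 cC LC K0 KC strict lip r0 r1 _ U_ucont F_ucont).
    by move=> y /(ball _ _ Ox)/subset_closure.
  by move=> y g yp y0 ym; rewrite !Fcl//; exact: f_sc.
have LC0 : 0 < 2 * Lam * C by rewrite !mulr_gt0.
split.
  move=> A cA AO; have [[a Aa]|A0] := pselect (A !=set0); last first.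
    by exists 1; split=> // x h _ Ax; case: A0; exists x.
  have d_cont : continuous d by have [dc _] := d_C2; move=> x; exact: dc.
  have [b + bmin] := compact_EVT_min (ex_intro _ a Aa) cA (continuous_subspaceT d_cont).
  rewrite inE => Ab; have db0 := d_pos _ (AO _ Ab).
  exists (2 * Lam * C / d b); split; first by rewrite divr_gt0.
  move=> x h Aph Ax Amh.
  have := interior x h (AO _ Ax); rewrite !Ucl; try exact/subset_closure/AO.
  move=> /le_trans; apply; rewrite ler_wpM2r ?sqr_ge0// ler_wpM2l ?(ltW LC0)//.
  have dx0 := d_pos _ (AO _ Ax).
  by rewrite lef_pV2 ?posrE//; apply: bmin; rewrite inE.
exists (2 * Lam * C); split=> // x Ox.
exists (d x / (2 * Lam)); split; first by rewrite divr_gt0 ?d_pos ?mulr_gt0.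
move=> h hM.
have Op : Omega (x + h) by apply: (ball x) => //; rewrite addrC addKr.
have Om : Omega (x - h) by apply: (ball x) => //; rewrite addrC addKr enormN.
split=> //; have := interior x h Ox.
by rewrite !Ucl//; exact: subset_closure.
Qed.
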